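(* Let $X$ be a connected, finite, simple $3$-valent graph embedded in the plane, and assume that the number of edges surrounding each face is divisible by $3$. Then: (1) the multiplicity of the eigenvalue $4$ of the Laplacian of $\mathrm{GC}_{2,0}(X)$ is at least $3$; (2) for any $k\in\mathbb{N}$, both $\mathrm{GC}_{k,0}(X)$ and $\mathrm{GC}_{k,k}(X)$ have Laplacian eigenvalue $4$ with multiplicity at least $\lceil k/2\rceil$, and Laplacian eigenvalue $2$ with multiplicity at least $\lfloor k/2\rfloor$.
   Context: The Laplacian of a graph $Y$ acts on $f\in\mathbb{C}^{V(Y)}$ by $(\Delta_Y f)(p)=\deg(p)f(p)-\sum_{q\sim p}f(q)$. A plane embedding gives each vertex the orientation (cyclic order of its three edges) induced by the counterclockwise orientation of the plane, and the Goldberg–Coxeter construction is taken with respect to it. Goldberg–Coxeter construction: let $\omega=e^{\pi i/3}$ and $\mathbb{Z}[\omega]$ the triangular lattice with its unit triangles. For $(k,l)\neq(0,0)$ put $z=k+l\omega$ and let $T$ be the triangle with vertices $0,z,\omega z$. For each $p\in V(X)$ take a copy $\overline{\triangle}(p)$ of the graph whose vertices are the barycenters of the unit lattice triangles meeting the interior of $T$, adjacent when the triangles share an edge; the sides of $T$ are matched with the edges at $p$ so that the cyclic order at $p$ agrees with the counterclockwise order of the sides. For each edge $e=pq$, place $\overline{\triangle}(p)$ on $T$ with $e$ corresponding to the side from $z$ to $\omega z$ and $\overline{\triangle}(q)$ (preserving orientation) on the triangle with vertices $z,(1+\omega)z,\omega z$ with $e$ corresponding to the side from $\omega z$ to $z$,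 and identify all overlapping vertices and edges. The result is the $3$-valent graph $\mathrm{GC}_{k,l}(X)$. *)

(* Defs.v *)
From HB Require Import structures.
From mathcomp Require Import all_boot all_order all_algebra.
From mathcomp Require Import algC.
From mathcomp Require Import boolp.

Set Implicit Arguments.
Unset Strict Implicit.
Unset Printing Implicit Defensive.

Import Order.TTheory GRing.Theory Num.Theory.
Local Open Scope ring_scope.

Record sgraph := SGraph { sv : finType ; sadj : rel sv }.

Definition sdeg (G : sgraph) (v : sv G) : nat := #|[set w | sadj v w]|.

Definition laplacian (G : sgraph) : 'M[algC]_#|sv G| :=
  \matrix_(i, j)
    ((if i == j then (sdeg (enum_val i))%:R else 0)
       - ((sadj (enum_val i) (enum_val j) : nat)%:R)).

(* multiplicity of the eigenvalue a of the Laplacian (= dimension of the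
   eigenspace; the Laplacian is symmetric). *)
Definition lap_mult (G : sgraph) (a : algC) : nat :=
  \rank (eigenspace (laplacian G) a).

(* Plane 3-valent graphs as genus-0 rotation systems.                        *)
(* A dart is (p, i) : V * 'I_3, the i-th edge at p; the cyclic order         *)
(* i -> i+1 (mod 3) is the counterclockwise order at p.  alpha sends a dart  *)
(* to the same edge seen from the other endpoint.                            *)

Section Cubic.
Variable V : finType.
Variable alpha : V * 'I_3 -> V * 'I_3.

Definition rot (d : V * 'I_3) : V * 'I_3 := (d.1, ordS d.2).
(* face permutation: its orbits are the faces of the embedding *)
Definition facep (d : V * 'I_3) : V * 'I_3 := rot (alpha d).

Definition nfaces : nat :=
  #|[set [set d' | fconnect facep d d'] | d in [set: V * 'I_3]]|.
Definition nedges : nat :=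
  #|[set [set d; alpha d] | d in [set: V * 'I_3]]|.

Definition graph_adj : rel V := fun p q => [exists i : 'I_3, (alpha (p, i)).1 == q].

Definition plane_cubic_graph : Prop :=
  [/\ (forall d, alpha (alpha d) = d),
      (forall d, (alpha d).1 != d.1),
      (forall p (i j : 'I_3), i != j -> (alpha (p, i)).1 != (alpha (p, j)).1),
      (forall p q, connect graph_adj p q)
    & (#|V| + nfaces = nedges + 2)%N ].                   (* Euler: genus 0 = plane *)

Definition faces_div3 : Prop := forall d, (3 %| order facep d)%N.

End Cubic.

(* The triangular lattice Z[w], w = e^{pi i/3}.  A point x + y w is the pair  *)
(* (x, y).  A unit lattice triangle is coded by 3 * its barycenter, i.e. by  *)
(* the sum of its vertices: up triangle (a,b),(a+1,b),(a,b+1) <-> (3a+1,3b+1); *)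
(* down triangle (a+1,b),(a+1,b+1),(a,b+1) <-> (3a+2,3b+2).                 *)

Definition ipt := (int * int)%type.
Definition qpt := (rat * rat)%type.

Definition is_tri (c : ipt) : bool :=
  (((c.1 - c.2) %% 3)%Z == 0) && (((c.1 %% 3)%Z) != 0).

Definition tri_verts (c : ipt) : ipt * ipt * ipt :=
  if ((c.1 %% 3)%Z == 1) then
    let a := ((c.1 - 1) %/ 3)%Z in let b := ((c.2 - 1) %/ 3)%Z in
    ((a, b), (a + 1, b), (a, b + 1))
  else
    let a := ((c.1 - 2) %/ 3)%Z in let b := ((c.2 - 2) %/ 3)%Z in
    ((a + 1, b), (a + 1, b + 1), (a, b + 1)).

Definition toQ (p : ipt) : qpt := (p.1%:~R, p.2%:~R).

(* orientation (sign preserved by (x,y) |-> x + y w since Im w > 0) *)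
Definition orient (A B W : qpt) : rat :=
  (B.1 - A.1) * (W.2 - A.2) - (B.2 - A.2) * (W.1 - A.1).

Definition in_open_tri (A B C W : qpt) : bool :=
  [&& 0 < orient A B W, 0 < orient B C W & 0 < orient C A W].

(* T = triangle 0, z, w z with z = k + l w; w z = -l + (k + l) w *)
Definition Tz (k l : nat) : ipt := (k%:Z, l%:Z).
Definition Twz (k l : nat) : ipt := (- (l%:Z), (k + l)%:Z).

(* the open unit triangle coded by c meets the interior of T (rational
   witnesses suffice since both are open subsets of the plane) *)
Definition meets_int (k l : nat) (c : ipt) : Prop :=
  exists W : qpt,
    in_open_tri (toQ (tri_verts c).1.1) (toQ (tri_verts c).1.2) (toQ (tri_verts c).2) W
    && in_open_tri (toQ (0, 0)) (toQ (Tz k l)) (toQ (Twz k l)) W.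

(* A finite box of codes containing every triangle meeting T. *)
Definition boxO (k l : nat) : nat := (3 * (k + l + 2))%N.
Definition cell (k l : nat) := ('I_(2 * boxO k l).+1 * 'I_(2 * boxO k l).+1)%type.
Definition coord (k l : nat) (c : cell k l) : ipt :=
  ((c.1 : nat)%:Z - (boxO k l)%:Z, (c.2 : nat)%:Z - (boxO k l)%:Z).

Definition piece (k l : nat) : {set cell k l} :=
  [set c | is_tri (coord c) && `[< meets_int k l (coord c) >]].

(* multiplication by w^2 = w - 1 : (x, y) |-> (-x-y, x) *)
Definition mulw2 (c : ipt) : ipt := (- c.1 - c.2, c.1).
(* rotation rho(u) = z + w^2 u of T: 0 -> z -> w z -> 0, side i -> side i+1
   (side 0 = [0,z], side 1 = [z, wz], side 2 = [wz, 0]); on codes (sums of 3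
   vertices) the translation is tripled. *)
Definition rho (k l : nat) (c : ipt) : ipt :=
  (3 * k%:Z + (mulw2 c).1, 3 * l%:Z + (mulw2 c).2).
(* point reflection u |-> (1 + w) z - u, (1 + w) z = (k - l) + (k + 2 l) w *)
Definition srefl (k l : nat) (c : ipt) : ipt :=
  (3 * (k%:Z - l%:Z) - c.1, 3 * (k%:Z + 2 * l%:Z) - c.2).
(* number of rotations bringing side i to side 1 *)
Definition rotidx (i : 'I_3) : nat := ((4 - i) %% 3)%N.

Definition isub (a b : ipt) : ipt := (a.1 - b.1, a.2 - b.2).
(* codes of edge-adjacent unit triangles differ by one of these *)
Definition nbvecs : seq ipt :=
  [:: (1, 1); (-1, -1); (-2, 1); (2, -1); (1, -2); (-1, 2)].

Section GC.
Variable V : finType.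
Variable alpha : V * 'I_3 -> V * 'I_3.
Variables k l : nat.

Definition gc_carrier : {set V * cell k l} := [set x | x.2 \in piece k l].

(* position of the element x of the disjoint union of the pieces in the
   chart of the edge of the dart d = (p, i), alpha d = (q, j): triangle(p)
   placed on T with this edge on side [z, wz], triangle(q) placed on the
   triangle z, (1+w)z, wz with the edge on [wz, z]. *)
Definition chart_pos (d : V * 'I_3) (x : V * cell k l) : option ipt :=
  let p := d.1 in let i := d.2 in let q := (alpha d).1 in let j := (alpha d).2 in
  if x.1 == p then Some (iter (rotidx i) (rho k l) (coord x.2))
  else if x.1 == q then Some (srefl k l (iter (rotidx j) (rho k l) (coord x.2)))
  else None.

Definition glue0 (x y : V * cell k l) : bool :=
  [&& x \in gc_carrier, y \in gc_carrier &
      [exists i : 'I_3, ((alpha (x.1, i)).1 == y.1)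
                        && (chart_pos (x.1, i) x == chart_pos (x.1, i) y)]].
Definition glue : rel (V * cell k l) := fun x y => glue0 x y || glue0 y x.

Definition gc_class (x : V * cell k l) : {set V * cell k l} :=
  [set y | connect glue x y].
Definition gc_verts : {set {set V * cell k l}} :=
  [set gc_class x | x in gc_carrier].

Definition GCvert := {S : {set V * cell k l} | S \in gc_verts}.

Definition chart_adj (d : V * 'I_3) (x y : V * cell k l) : bool :=
  match chart_pos d x, chart_pos d y with
  | Some a, Some b => isub a b \in nbvecs
  | _, _ => false
  end.

Definition gc_adj : rel GCvert := fun S T =>
  (val S != val T) &&
  [exists d : V * 'I_3, exists x in val S, exists y in val T, chart_adj d x y].

Definition GC : sgraph := @SGraph GCvert gc_adj.

End GC.

(* Main.v *)
Require Import Defs.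
From mathcomp Require Import all_boot all_order all_algebra.
From mathcomp Require Import algC.
From mathcomp Require Import boolp.
From mathcomp Require Import zify ring lra.

(* If all face lengths are divisible by 3, the edges of [X] can be 3-coloured *)
(* so that the colours appear in counterclockwise order at every vertex, and *)
(* then the vertices can be labelled by (Z/2)^2 so that the label changes by a *)
(* nonzero element determined by the colour of the edge crossed: on the sphere *)
(* the only obstructions are sums around faces. The two labellings develop [X] *)
(* onto the tetrahedron, so GC_{k,l}(X) maps to the hexagonal lattice modulo *)
(* the group generated by [u |-> -u] and the translations by [2z] and [2wz]. *)
(* This map is locally bijective, hence functions on the lattice invariant *)
(* under that group pull back to functions on GC_{k,l}(X) with the same *)
(* adjacency eigenvalue. The eigenvalues 1 and -1 of the lattice have *)
(* eigenfunctions supported on the triangles with a side on one horizontal *)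
(* line, with alternating signs; symmetrizing over the lines of height *)
(* congruent to [j] or [-j] mod [2k] yields at least [k - 1], resp. [k], *)
(* independent eigenfunctions. *)

Set Implicit Arguments.
Unset Strict Implicit.
Unset Printing Implicit Defensive.

Import Order.TTheory GRing.Theory Num.Theory.
Local Open Scope ring_scope.

(** The cohomological input is [closed_exact], applied over ['F_3] for the colours ([edge_coloring])
    and twice over ['F_2] for the labels ([vertex_shift]). No covering map is built: [frames] turns
    an invariant lattice function [F] into a family [Fd] that reads [F] in the chart of each dart,
    and compatibility with [rho] and [srefl] makes it descend to glued vertices. [GC_nbhd] is local
    bijectivity, and it uses the shape of the pieces only through [tame]. So, by [GC_mult_ge],
    invariant lattice eigenfunctions for [e] with dual test triangles yield independent Laplacian
    eigenfunctions for [3 - e]. They are [strip] functions weighted by [wave]. Heights [0..k-1] give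
    [k] functions for Laplacian eigenvalue 4, and heights [1..k-1] give [k - 1] for 2; these
    dominate the halves of [k] rounded up and down. For [k = 2], [l = 0] the line of height 2 adds a
    third function for 4. *)

Local Notation rot := Defs.rot.
Local Notation coord := Defs.coord.

(** * Closed cochains on a plane cubic graph are exact *)

(** Selecting the columns [e] of [U] leaves an identity matrix. Independence of block indicators and
    of eigenfunctions is shown this way. *)
Lemma rank_ge_dual (F : fieldType) n (T : finType) (U : 'M[F]_(n, #|T|))
    (e : 'I_n -> T) :
  (forall i j, U i (enum_rank (e j)) = (i == j)%:R) -> (n <= \rank U)%N.
Proof.
move=> He; pose R := \matrix_(x < #|T|, j < n) (x == enum_rank (e j))%:R : 'M[F]_(_, _).
have E : U *m R = 1%:M.
  apply/matrixP => i j; rewrite !mxE (bigD1 (enum_rank (e j))) //= big1 => [|x /negPf nx].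
    by rewrite mxE eqxx mulr1 addr0 He.
  by rewrite mxE nx mulr0.
by have := mxrankM_maxl U R; rewrite E mxrank1.
Qed.

Lemma constant_row_sub (F : fieldType) (T : finType) (u : 'rV[F]_#|T|) :
  (forall x y, u 0 (enum_rank x) = u 0 (enum_rank y)) ->
  (u <= (const_mx 1 : 'rV_#|T|))%MS.
Proof.
move=> cst; have [T0|] := posnP #|T|.
  by rewrite (_ : u = 0) ?sub0mx //; apply/rowP => j; have := ltn_ord j; rewrite [X in (_ < X)%N]T0.
move=> T0; have -> : u = u 0 (Ordinal T0) *: const_mx 1.
  apply/rowP => j; rewrite !mxE mulr1.
  by rewrite -[j]enum_valK -[Ordinal T0]enum_valK; apply: cst.
exact: scalemx_sub.
Qed.

Lemma sum_mul_delta (F : nzRingType) (T : finType) (u : 'rV[F]_#|T|) x :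
  \sum_(j < #|T|) u 0 j * (x == enum_val j)%:R = u 0 (enum_rank x).
Proof.
rewrite (bigD1 (enum_rank x)) //= enum_rankK eqxx mulr1 big1 ?addr0 // => j nj.
by rewrite -(inj_eq enum_rank_inj) enum_valK eq_sym (negPf nj) mulr0.
Qed.

Lemma blocks_partition (T : finType) (b : T -> {set T}) :
  (forall x, x \in b x) -> (forall x y, y \in b x -> b y = b x) ->
  partition (b @: setT) setT.
Proof.
move=> bx bE; apply/and3P; split.
- apply/eqP/setP => x; rewrite inE; apply/bigcupP.
  by exists (b x) => //; apply: imset_f.
- apply/trivIsetP => _ _ /imsetP[x _ ->] /imsetP[y _ ->] nxy.
  rewrite disjoint_subset; apply/subsetP => u ux; apply: contra nxy => uy.
  by rewrite -(bE _ _ ux) -(bE _ _ uy).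
- by apply/negP => /imsetP[x _ /setP/(_ x)]; rewrite bx inE.
Qed.

Section Indicator.
Variables (F : fieldType) (T : finType) (P : {set {set T}}).

Definition indic_mx : 'M[F]_(#|P|, #|T|) :=
  \matrix_(i < #|P|, j < #|T|) ((enum_val j : T) \in (enum_val i : {set T}))%:R.

Lemma indic_mx_rank : trivIset P -> set0 \notin P -> (#|P| <= \rank indic_mx)%N.
Proof.
move=> tP P0.
have /fin_all_exists[e He] (i : 'I_#|P|) : exists x : T, x \in (enum_val i : {set T}).
  by apply/set0Pn; apply: contra P0 => /eqP <-; apply: enum_valP.
apply: (@rank_ge_dual _ _ _ _ e) => i j; rewrite mxE enum_rankK.
case: eqP => [<-|/eqP ne]; first by rewrite He.
have nv : enum_val j != enum_val i by rewrite (inj_eq enum_val_inj) eq_sym.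
by move/trivIsetP: tP => /(_ _ _ (enum_valP j) (enum_valP i) nv) /disjointFr ->.
Qed.

(** A combination of block indicators is constant on blocks, hence invariant under any map that
    preserves each block. *)
Lemma indic_mx_sub (f : T -> T) (u : 'rV_#|T|) :
  (forall A x, A \in P -> (f x \in A) = (x \in A)) ->
  (u <= indic_mx)%MS -> forall x, u 0 (enum_rank (f x)) = u 0 (enum_rank x).
Proof.
move=> Hf /submxP[w ->] x; rewrite !mxE; apply: eq_bigr => i _.
by rewrite !mxE !enum_rankK Hf ?enum_valP.
Qed.

Lemma mul_tr_indic_mx (g : T -> F) i :
  ((\row_(j < #|T|) g (enum_val j)) *m indic_mx^T) 0 i = \sum_(x in (enum_val i : {set T})) g x.
Proof.
rewrite mxE [RHS]big_mkcond (reindex (@enum_val T T)) /=; last first.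
  by exists enum_rank => x _; rewrite ?enum_rankK ?enum_valK.
by apply: eq_bigr => j _; rewrite !mxE; case: ifP; rewrite ?mulr1 ?mulr0.
Qed.

End Indicator.

Section Cubic.
Variables (V : finType) (alpha : V * 'I_3 -> V * 'I_3).
Hypothesis HX : plane_cubic_graph alpha.
Local Notation D := (V * 'I_3)%type.
Local Notation facep := (facep alpha).

Let aK : involutive alpha. Proof. by case: HX. Qed.

Lemma rotK3 (d : D) : rot (rot (rot d)) = d.
Proof. by case: d => p [[|[|[|i]]] ?] //; congr pair; apply: val_inj. Qed.

Lemma facep_inj : injective facep.
Proof.
move=> x y /(congr1 (fun d => rot (rot d))).
by rewrite !rotK3 => /(can_inj aK).
Qed.

Lemma rot_const (A : Type) (phi : D -> A) :
  (forall d, phi (rot d) = phi d) -> forall p i j, phi (p, i) = phi (p, j).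
Proof.
move=> Hr p.
have E (i : 'I_3) : phi (p, i) = phi (p, ord0).
  case: i => -[|[|[|i]]] lti //; [congr phi | rewrite -[RHS]Hr; congr phi |
   rewrite -[RHS]Hr -[RHS]Hr; congr phi]; congr pair; exact: val_inj.
by move=> i j; rewrite E [RHS]E.
Qed.

Lemma vertex_const (A : eqType) (phi : V -> A) :
  (forall d, phi (alpha d).1 = phi d.1) -> forall p q, phi p = phi q.
Proof.
move=> H p q; case: HX => _ _ _ /(_ p q) cpq _.
have := closed_connect (a := [pred x | phi x == phi p]) _ cpq.
rewrite !inE eqxx => E; apply/esym/eqP/esym/E => x y /existsP[i /eqP <-].
by rewrite !inE H.
Qed.

(** [rot] is [facep] after [alpha], so [phi] is constant around each vertex, and connectedness does
    the rest. *)
Lemma dart_const (A : eqType) (phi : D -> A) :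
  (forall d, phi (alpha d) = phi d) -> (forall d, phi (facep d) = phi d) ->
  forall d d', phi d = phi d'.
Proof.
move=> Ha Hf; have Hr d : phi (rot d) = phi d.
  have -> : rot d = facep (alpha d) by rewrite /Defs.facep aK.
  by rewrite Hf Ha.
have R := rot_const Hr.
have C := @vertex_const _ (fun p => phi (p, ord0)).
move=> [p i] [q j]; rewrite (R p i ord0) (R q j ord0); apply: C => d.
by rewrite (R _ ord0 (alpha d).2) -surjective_pairing Ha (surjective_pairing d); apply: R.
Qed.

Let eb d : {set D} := [set d; alpha d].
Let fb d : {set D} := [set d' | fconnect facep d d'].
Let EE := eb @: setT.
Let FF := fb @: setT.

Let ebP : partition EE setT.
Proof.
apply: blocks_partition => [x|x y]; first by rewrite !inE eqxx.
by rewrite !inE => /orP[]/eqP-> //; rewrite /eb aK setUC.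
Qed.

Let fbP : partition FF setT.
Proof.
apply: blocks_partition => [x|x y]; first by rewrite inE connect0.
rewrite inE => xy; apply/setP => u; rewrite !inE.
by rewrite (same_connect (fconnect_sym facep_inj) xy).
Qed.

Let card_darts : (3 * #|V| = 2 * nedges alpha)%N.
Proof.
have := card_uniform_partition (n := 2) _ ebP.
rewrite cardsT card_prod card_ord mulnC => ->; first by rewrite mulnC.
move=> _ /imsetP[d _ ->]; rewrite cards2.
case: HX => _ /(_ d) nd _ _ _; case: eqP => // E.
by move: nd; rewrite -E eqxx.
Qed.

Let stable_alpha A x : A \in EE -> (alpha x \in A) = (x \in A).
Proof.
move=> /imsetP[d _ ->]; rewrite !inE -{1}(aK d) !(can_eq aK).
by rewrite orbC.
Qed.

Let stable_facep A x : A \in FF -> (facep x \in A) = (x \in A).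
Proof.
move=> /imsetP[d _ ->]; rewrite !inE; apply/esym/(same_connect1r (fconnect_sym facep_inj)).
exact/eqP.
Qed.

Section Cochain.
Variable F : fieldType.

Let MP := indic_mx F EE.
Let MQ := indic_mx F FF.
Let MC := col_mx MP MQ.
Let MB : 'M[F]_(#|V|, #|{: D}|) :=
  \matrix_(p, j) ((((enum_val j).1 == enum_val p)%:R)
                  - ((alpha (enum_val j)).1 == enum_val p)%:R).

(** The spans of the edge and face indicators meet in functions invariant under [alpha] and [facep],
    that is, in constants, so at most one dimension is lost. *)
Let rank_MC : (nedges alpha + nfaces alpha <= (\rank MC).+1)%N.
Proof.
have /and3P[_ tP P0] := ebP; have /and3P[_ tQ Q0] := fbP.
have rP := indic_mx_rank F tP P0; have rQ := indic_mx_rank F tQ Q0.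
have := mxrank_sum_cap MP MQ; rewrite addsmxE => E.
have : (\rank (MP :&: MQ) <= 1)%N.
  have /mxrankS/leq_trans -> // : (MP :&: MQ <= (const_mx 1 : 'rV[F]_#|{: D}|))%MS;
    last exact: rank_leq_row.
  apply/row_subP => i; set u := row i _.
  have : (u <= MP :&: MQ)%MS by apply: row_sub.
  rewrite sub_capmx => /andP[/indic_mx_sub uP /indic_mx_sub uQ].
  exact: (constant_row_sub (dart_const (uP alpha stable_alpha) (uQ facep stable_facep))).
have key (a b c d e f : nat) :
  (a + d = b + c -> e <= b -> f <= c -> d <= 1 -> e + f <= a.+1)%N by lia.
exact: key E rP rQ.
Qed.

Let ker_MB : (\rank (kermx MB) <= 1)%N.
Proof.
have /mxrankS/leq_trans -> // : (kermx MB <= (const_mx 1 : 'rV[F]_#|V|))%MS;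
  last exact: rank_leq_row.
apply/row_subP => i; set u := row i _.
have /sub_kermxP uB : (u <= kermx MB)%MS by apply: row_sub.
apply: constant_row_sub; apply: (@vertex_const _ (fun p => u 0 (enum_rank p))) => d.
move/rowP: uB => /(_ (enum_rank d)); rewrite [LHS]mxE [RHS]mxE.
rewrite (eq_bigr (fun j => u 0 j * (d.1 == enum_val j)%:R
     - u 0 j * ((alpha d).1 == enum_val j)%:R)) => [|j _].
  by rewrite sumrB !sum_mul_delta => /eqP; rewrite subr_eq0 => /eqP.
by rewrite [MB _ _]mxE enum_rankK mulrBr.
Qed.

(** [pi d] starts where [d] ends, so reindexing by [pi] turns the sum over tails into the sum over
    heads. It is used with [alpha] on edges and [facep] on faces. *)
Let stable_sum (pi : D -> D) (A : {set D}) p : injective pi ->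
  (forall d, (pi d).1 = (alpha d).1) -> (forall d, (pi d \in A) = (d \in A)) ->
  \sum_(d in A) ((d.1 == p)%:R - ((alpha d).1 == p)%:R) = 0 :> F.
Proof.
move=> pi_inj pi1 piA; rewrite sumrB (reindex_inj pi_inj) /=.
by apply/eqP; rewrite subr_eq0; apply/eqP; apply: eq_big => // d _; rewrite pi1.
Qed.

Let MB_MC : MB *m MC^T = 0.
Proof.
have E (P : {set {set D}}) pi : injective pi ->
    (forall d, (pi d).1 = (alpha d).1) ->
    (forall A d, A \in P -> (pi d \in A) = (d \in A)) -> MB *m (indic_mx F P)^T = 0.
  move=> pi_inj pi1 piP; apply/matrixP => p i; rewrite [RHS]mxE.
  have Z := stable_sum (enum_val p) pi_inj pi1 (fun d => piP _ d (enum_valP i)).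
  apply: etrans Z; apply: etrans (mul_tr_indic_mx _ i).
  by rewrite !mxE; apply: eq_bigr => j _; rewrite !mxE.
rewrite /MC tr_col_mx mul_mx_row (E EE alpha) ?(E FF facep) ?row_mx0 //.
- exact: facep_inj.
- exact: can_inj aK.
Qed.

(* Exact cochains lie in the orthogonal complement of the indicators of the *)
(* edges and faces, and by Euler's formula its dimension is at most [#|V| - 1]. *)
Lemma closed_exact (g : D -> F) :
  (forall d, g (alpha d) = - g d) ->
  (forall d, \sum_(t < order facep d) g (iter t facep d) = 0) ->
  exists s : V -> F, forall d, s d.1 - s (alpha d).1 = g d.
Proof.
move=> gE gF; pose u : 'rV_#|{: D}| := \row_j g (enum_val j).
have uP : u *m MP^T = 0.
  apply/rowP => i; rewrite mul_tr_indic_mx [RHS]mxE.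
  have /imsetP[d _ ->] := enum_valP i.
  rewrite big_setU1 /= ?big_set1 ?gE ?subrr // inE eq_sym.
  by apply: contraTneq isT => E; case: HX => _ /(_ d); rewrite E eqxx.
have uQ : u *m MQ^T = 0.
  apply/rowP => i; rewrite mul_tr_indic_mx [RHS]mxE.
  have /imsetP[d _ ->] := enum_valP i.
  rewrite -[RHS](gF d) (eq_bigl (mem (orbit facep d))) => [|x]; last by rewrite inE fconnect_orbit.
  rewrite -big_uniq ?orbit_uniq //= (big_nth d) size_traject big_mkord.
  by apply: eq_bigr => t _; rewrite nth_traject.
have uB : (u <= MB)%MS.
  have BK : (MB <= kermx MC^T)%MS by apply/sub_kermxP.
  have uK : (u <= kermx MC^T)%MS.
    by apply/sub_kermxP; rewrite /MC tr_col_mx mul_mx_row uP uQ row_mx0.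
  apply: submx_trans uK _; rewrite -(mxrank_leqif_sup BK).
  rewrite eqn_leq mxrankS // mxrank_ker mxrank_tr.
  have cD : #|{: D}| = (3 * #|V|)%N by rewrite card_prod card_ord mulnC.
  (* With [3v = 2e], Euler's formula [v + f = e + 2] makes [3v - (e + f - 1)] equal to [v - 1]. *)
  have key (v e f rB rC rK n : nat) : (v + f = e + 2 -> 3 * v = 2 * e -> e + f <= rC.+1 ->
    rK <= 1 -> rB <= v -> rK = v - rB -> n = 3 * v -> n - rC <= rB)%N by lia.
  case: HX => _ _ _ _ Eu.
  exact: key Eu card_darts rank_MC ker_MB (rank_leq_row MB) (mxrank_ker MB) cD.
case/submxP: uB => w Ew; exists (fun p => w 0 (enum_rank p)) => d.
have := congr1 (fun M : 'rV_ _ => M 0 (enum_rank d)) Ew.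
rewrite !mxE enum_rankK => ->.
rewrite -!sum_mul_delta -sumrB; apply: eq_bigr => j _.
by rewrite [MB _ _]mxE enum_rankK mulrBr.
Qed.
End Cochain.
End Cubic.

(** * Developing the graph *)

Lemma ordSE (i : 'I_3) : ordS i = (i : 'F_3) + 1.
Proof. by apply: val_inj; case: i => -[|[|[|]]]. Qed.

Lemma rhoK3 k l c : rho k l (rho k l (rho k l c)) = c.
Proof. by case: c => a b; rewrite /rho /mulw2 /=; congr pair; ring. Qed.

Lemma sreflK k l : involutive (srefl k l).
Proof. by case=> a b; rewrite /srefl /=; congr pair; ring. Qed.

Section Labels.
Variables (V : finType) (alpha : V * 'I_3 -> V * 'I_3).
Hypothesis HX : plane_cubic_graph alpha.
Hypothesis H3 : faces_div3 alpha.
Local Notation D := (V * 'I_3)%type.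
Local Notation facep := (facep alpha).

Let aK : involutive alpha. Proof. by case: HX. Qed.

(* Crossing an edge keeps the colour and turning left increments it, so a face *)
(* of length [n] is an obstruction exactly when [n] is nonzero mod 3. *)
Lemma edge_coloring (d0 : D) : exists c : D -> 'I_3,
  [/\ forall d, c (rot d) = ordS (c d), forall d, c (alpha d) = c d & c d0 = ord0].
Proof.
(* The numbering of darts already increases under [rot], but the ends of an edge disagree by
   [x d - x (alpha d)]; a potential [s] for this cochain corrects the numbering vertex by vertex. *)
pose x (d : D) : 'F_3 := d.2.
have [||s Hs] := @closed_exact _ _ HX 'F_3 (fun d => x d - x (alpha d)).
- by move=> d; rewrite aK opprB.
- move=> d; have E t : x (iter t facep d) - x (alpha (iter t facep d))
      = x (iter t facep d) - x (iter t.+1 facep d) + 1.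
    by rewrite iterS {3}/Defs.facep /x /= ordSE opprD addrA subrK.
  under eq_bigr do rewrite E.
  rewrite big_split /= sumr_const card_ord.
  rewrite -(big_mkord xpredT (fun t => x (iter t facep d) - x (iter t.+1 facep d))).
  rewrite (telescope_sumr_eq (fun t => - x (iter t facep d))) //; last first.
    by move=> t _; rewrite opprK addrC.
  rewrite iter_order ?subrr ?add0r; last exact: (facep_inj HX).
  have /dvdnP[m ->] := H3 d; rewrite mulnC natrM.
  by rewrite (_ : 3%:R = 0 :> 'F_3) ?mul0r //; apply: val_inj.
exists (fun d => (x d - s d.1) - (x d0 - s d0.1) : 'F_3); split => [d|d|].
- by rewrite ordSE /x /= ordSE -!addrA; congr (_ + _); rewrite addrC !addrA.
- congr (_ - _); move/eqP: (Hs d); rewrite -subr_eq0 => /eqP E.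
  by apply/eqP; rewrite -subr_eq0 -E; apply/eqP; ring.
- by rewrite subrr.
Qed.

Lemma sum_period3 (F : nmodType) (e : 'I_3 -> F) m c :
  \sum_i e i = 0 -> \sum_(t < 3 * m) e (iter t (@ordS 3) c) = 0.
Proof.
move=> e0; have per t : iter (3 * t) (@ordS 3) c = c.
  elim: t => // t IH; rewrite mulnS iterD IH.
  by apply: val_inj; case: (c) => -[|[|[|]]].
elim: m => [|m IH]; first by rewrite muln0 big_ord0.
rewrite mulnS addnC addn3 !big_ord_recr /= IH !per add0r -[RHS]e0.
rewrite !big_ord_recr big_ord0 /= add0r.
case: (c) => -[|[|[|]]] //= ?; [|rewrite [LHS]addrC addrA|rewrite -[LHS]addrA [LHS]addrC];
  do ?congr (_ + _); congr (e _); exact: val_inj.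
Qed.

(** Along a face the colour goes up by one at each step, so a length divisible by 3 meets all
    colours equally often and the sum of [e] vanishes. Signs are invisible in ['F_2]. *)
Lemma vertex_shift (c : D -> 'I_3) (e : 'I_3 -> 'F_2) (p0 : V) :
  (forall d, c (rot d) = ordS (c d)) -> (forall d, c (alpha d) = c d) ->
  \sum_i e i = 0 ->
  exists s : V -> 'F_2, s p0 = 0 /\ forall d, s (alpha d).1 = s d.1 + e (c d).
Proof.
move=> cr ca e0.
have N2 (x : 'F_2) : - x = x by apply: val_inj; case: x => -[|[|]].
have [||s Hs] := @closed_exact _ _ HX 'F_2 (fun d => e (c d)).
- by move=> d; rewrite ca N2.
- move=> d; have E t : c (iter t facep d) = iter t (@ordS 3) (c d).
    by elim: t => //= t <-; rewrite cr ca.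
  under eq_bigr do rewrite E.
  by have /dvdnP[m ->] := H3 d; rewrite mulnC; apply: sum_period3.
exists (fun p => s p - s p0); split => [|d]; first by rewrite subrr.
by rewrite -(Hs d) -(N2 (s d.1 - s (alpha d).1)); ring.
Qed.

Section Frames.
Variables (k l : nat) (A : Type) (F : ipt -> A).
Hypothesis FN : forall a b, F (- a, - b) = F (a, b).
(* Invariance under translation by [2z] and [2wz], tripled as all codes are. *)
Hypothesis FT : forall (m n : int) a b,
  F (a + 6 * m * k%:Z - 6 * n * l%:Z, b + 6 * m * l%:Z + 6 * n * (k + l)%:Z) = F (a, b).

(** [Fd d] evaluates [F] after developing the chart of [d], whose edge is side 1: [c d] rotations,
    then translation by [s z + t w z]. Crossing the edge is the half turn about the midpoint of the
    rotated side. Twice that midpoint is [z + w z], [w z], [z] for colours 0, 1, 2, which dictates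
    the two functions given to [vertex_shift]. *)
Lemma frames (d0 : D) : exists Fd : D -> ipt -> A,
  [/\ forall d u, Fd (rot d) u = Fd d (rho k l u),
      forall d u, Fd (alpha d) u = Fd d (srefl k l u)
    & Fd d0 =1 F].
Proof.
have [c [cr ca c0]] := edge_coloring d0.
have [|s [s0 Hs]] := @vertex_shift c (fun i => (i != 1%N :> nat)%:R) d0.1 cr ca.
  by rewrite !big_ord_recr big_ord0 /=; apply: val_inj.
have [|t [t0 Ht]] := @vertex_shift c (fun i => (i != 2%N :> nat)%:R) d0.1 cr ca.
  by rewrite !big_ord_recr big_ord0 /=; apply: val_inj.
pose T (m n : nat) (u : ipt) : ipt :=
  (u.1 + 3 * m%:Z * k%:Z - 3 * n%:Z * l%:Z, u.2 + 3 * m%:Z * l%:Z + 3 * n%:Z * (k + l)%:Z).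
exists (fun d u => F (T (s d.1) (t d.1) (iter (c d) (rho k l) u))); split.
- move=> d u; rewrite cr /= -iterSr; congr (F (T _ _ _)).
  by case: (c d) => -[|[|[|]]] //= _; rewrite rhoK3.
- move=> d u; rewrite ca Hs Ht /T.
  (* The lift of [x + b] to 0 or 1 differs from [-b - x] by an even number, which [FT] absorbs once
     [FN] has changed the sign. *)
  have mod2 (x : 'F_2) (b : bool) : exists m : int,
    Posz (nat_of_ord (x + b%:R)%R) = 2 * m - b%:Z - x%:Z.
    by case: x => -[|[|]] //= ?; case: b => /=; [exists 1|exists 0|exists 1|exists 1].
  have [m ->] := mod2 (s d.1) (c d != 1%N :> nat).
  have [n ->] := mod2 (t d.1) (c d != 2%N :> nat).
  set x := (s d.1)%:Z; set y := (t d.1)%:Z; case: u => a b.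
  case: (c d) => -[|[|[|]]] //= _; rewrite /srefl /rho /mulw2 /= ?subr0;
    by rewrite -[RHS]FN -[RHS](FT m n); congr F; congr pair; ring.
- by move=> u; rewrite c0 s0 t0 /T /=; congr F; case: u => a b /=; congr pair; ring.
Qed.
End Frames.
End Labels.

(** * Lattice triangles *)

Definition in_piece (k l : nat) (c : ipt) : bool := is_tri c && `[< meets_int k l c >].

Definition toside1 (k l : nat) (i : 'I_3) : ipt -> ipt := iter (rotidx i) (rho k l).

(* [c], in the frame of one piece, lies in the piece glued along side [i]. *)
Definition beyond (k l : nat) (i : 'I_3) (c : ipt) : bool :=
  in_piece k l (srefl k l (toside1 k l i c)).

Definition tri_adj (c c' : ipt) : bool :=
  [&& is_tri c, is_tri c' & isub c c' \in nbvecs].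

Definition tri_nbrs (c : ipt) : seq ipt :=
  if (c.1 %% 3)%Z == 1
  then [:: (c.1 + 1, c.2 + 1); (c.1 - 2, c.2 + 1); (c.1 + 1, c.2 - 2)]
  else [:: (c.1 - 1, c.2 - 1); (c.1 + 2, c.2 - 1); (c.1 - 1, c.2 + 2)].

Lemma is_triP c :
  reflect (exists a b, c = (3 * a + 1, 3 * b + 1) \/ c = (3 * a + 2, 3 * b + 2)) (is_tri c).
Proof.
case: c => x y; apply: (iffP idP); rewrite /is_tri /=.
  move=> /andP[/eqP h1 /eqP h2].
  exists (x %/ 3)%Z, (y %/ 3)%Z.
  have [h3|h3] : (x %% 3)%Z = 1 \/ (x %% 3)%Z = 2 by lia.
    by left; congr pair; lia.
  by right; congr pair; lia.
by move=> [a [b [[-> ->]|[-> ->]]]]; lia.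
Qed.

Lemma mem_tri_nbrs c c' : is_tri c -> (c' \in tri_nbrs c) = tri_adj c c'.
Proof.
move=> tc; rewrite /tri_adj tc /=; case/is_triP: tc => a [b E].
case: c' => x y.
rewrite /tri_nbrs /is_tri /isub !inE -!pair_eqE /=.
by case: E => -> /=; case: ifP => ?; rewrite !inE -!pair_eqE /=; lia.
Qed.

Lemma tri_nbrs_uniq c : uniq (tri_nbrs c).
Proof. by rewrite /tri_nbrs; case: ifP => _; rewrite /= !inE -!pair_eqE /=; lia. Qed.

Lemma is_tri_rho k l c : is_tri (rho k l c) = is_tri c.
Proof. by case: c => a b; rewrite /rho /mulw2 /is_tri /=; lia. Qed.

Lemma is_tri_srefl k l c : is_tri (srefl k l c) = is_tri c.
Proof. by case: c => a b; rewrite /srefl /is_tri /=; lia. Qed.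

Lemma nbvecs_rho k l c c' :
  (isub (rho k l c) (rho k l c') \in nbvecs) = (isub c c' \in nbvecs).
Proof.
have /allP H : all (fun v => (- v.1 - v.2, v.1) \in nbvecs) nbvecs by [].
rewrite (_ : isub _ _ = (- (isub c c').1 - (isub c c').2, (isub c c').1)); last first.
  by rewrite /isub /rho /mulw2 /=; congr pair; ring.
case: (isub c c') => x y /=; apply/idP/idP => [/H /= /H /=|/H //].
by rewrite (_ : (_, _) = (x, y)) //; congr pair; ring.
Qed.

Lemma nbvecs_opp c c' : (isub c' c \in nbvecs) = (isub c c' \in nbvecs).
Proof.
have /allP H : all (fun v => (- v.1, - v.2) \in nbvecs) nbvecs by [].
by apply/idP/idP => /H; rewrite /isub /= !opprB.
Qed.

Lemma nbvecs_srefl k l c c' :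
  (isub (srefl k l c) (srefl k l c') \in nbvecs) = (isub c c' \in nbvecs).
Proof.
have -> : isub (srefl k l c) (srefl k l c') = isub c' c.
  by rewrite /isub /srefl /=; congr pair; ring.
exact: nbvecs_opp.
Qed.

Lemma tri_adj_rho k l c c' : tri_adj (rho k l c) (rho k l c') = tri_adj c c'.
Proof. by rewrite /tri_adj !is_tri_rho nbvecs_rho. Qed.

Lemma tri_adj_srefl k l c c' : tri_adj (srefl k l c) (srefl k l c') = tri_adj c c'.
Proof. by rewrite /tri_adj !is_tri_srefl nbvecs_srefl. Qed.

Lemma tri_adj_toside1 k l i c c' :
  tri_adj (toside1 k l i c) (toside1 k l i c') = tri_adj c c'.
Proof. by rewrite /toside1; elim: (rotidx i) => //= n; rewrite tri_adj_rho. Qed.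

Definition fromside1 (k l : nat) (i : 'I_3) : ipt -> ipt := iter (3 - rotidx i) (rho k l).

Lemma fromside1K k l i : cancel (fromside1 k l i) (toside1 k l i).
Proof. by case: i => -[|[|[|]]] // ? c; rewrite /fromside1 /toside1 /= !rhoK3. Qed.

Lemma toside1K k l i : cancel (toside1 k l i) (fromside1 k l i).
Proof. by case: i => -[|[|[|]]] // ? c; rewrite /fromside1 /toside1 /= !rhoK3. Qed.

(** * Local structure of the Goldberg-Coxeter graph *)

(* [tame_exit]: a step leaving the piece crosses exactly one side, and if the *)
(* starting triangle is itself cut by a side, it is that one. *)
Record tame (k l : nat) : Prop := Tame {
  tame_exit : forall c c', in_piece k l c -> tri_adj c c' -> in_piece k l c' \/
    exists i, beyond k l i c' /\ (forall j, beyond k l j c -> j = i);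
  tame_corner : forall i j c, beyond k l i c -> beyond k l j c -> i != j ->
    in_piece k l c;
  tame_box : forall c, in_piece k l c -> exists x : cell k l, coord x = c;
  tame_rho : forall c, in_piece k l (rho k l c) = in_piece k l c }.

Lemma someI (T : Type) (x y : T) : Some x = Some y -> x = y.
Proof. by case. Qed.

Section Local.
Variables (V : finType) (alpha : V * 'I_3 -> V * 'I_3).
Hypothesis HX : plane_cubic_graph alpha.
Variables (k l : nat).
Hypothesis Hkl : tame k l.
Local Notation D := (V * 'I_3)%type.
Local Notation W := (V * cell k l)%type.
Local Notation sigma := (srefl k l).
Local Notation R := (toside1 k l).
Local Notation Rinv := (fromside1 k l).
Local Notation chart_pos := (chart_pos alpha).
Local Notation carrier := (gc_carrier V k l).
Local Notation glue := (@glue V alpha k l).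

Let aK : involutive alpha. Proof. by case: HX. Qed.

Let a_neq d : (alpha d).1 == d.1 = false. Proof. by case: HX => _ /(_ d) /negPf. Qed.

Lemma carrierE (x : W) : (x \in carrier) = in_piece k l (coord x.2).
Proof. by rewrite !inE. Qed.

Lemma coord_inj : injective (@Defs.coord k l).
Proof.
move=> [[a ?] [b ?]] [[c ?] [d ?]]; rewrite /coord /= => -[E1 E2].
by congr pair; apply: val_inj => /=; lia.
Qed.

Lemma chart_pos1 (x : W) d : x.1 = d.1 -> chart_pos d x = Some (R d.2 (coord x.2)).
Proof. by move=> E; rewrite /Defs.chart_pos E eqxx. Qed.

Lemma chart_pos2 (x : W) d : x.1 = (alpha d).1 ->
  chart_pos d x = Some (sigma (R (alpha d).2 (coord x.2))).
Proof. by move=> E; rewrite /Defs.chart_pos E a_neq eqxx. Qed.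

Lemma chart_pos_alpha (x : W) d : chart_pos (alpha d) x = omap sigma (chart_pos d x).
Proof.
have [E1|n1] := eqVneq x.1 d.1.
  by rewrite chart_pos2 ?aK // chart_pos1.
have [E2|n2] := eqVneq x.1 (alpha d).1.
  by rewrite chart_pos1 // chart_pos2 //= sreflK.
by rewrite /Defs.chart_pos aK (negPf n1) (negPf n2).
Qed.

Lemma in_piece_toside1 i c : in_piece k l (R i c) = in_piece k l c.
Proof. by rewrite /toside1; elim: (rotidx i) => //= n; rewrite (tame_rho Hkl). Qed.

(** [y] is a copy of the triangle [c] of the frame of [p], either in the piece of [p] or in a
    neighbouring piece that covers [c] in their common chart. *)
Definition realizes (p : V) (c : ipt) (y : W) : bool :=
  (y \in carrier) && [exists i : 'I_3, chart_pos (p, i) y == Some (R i c)].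

Lemma realizesP p c y :
  reflect ((y \in carrier) /\ (y.1 = p /\ coord y.2 = c \/
     exists2 i, y.1 = (alpha (p, i)).1 & sigma (R (alpha (p, i)).2 (coord y.2)) = R i c))
    (realizes p c y).
Proof.
apply: (iffP andP) => -[yc H]; split => //.
  have /existsP[i] := H; rewrite /Defs.chart_pos /=.
  case: (y.1 =P p) => [E|_]; [move=> /eqP H1; have H2 := someI H1|].
    by left; split=> //; apply: (can_inj (@toside1K k l i)).
  by case: (y.1 =P (alpha (p, i)).1) => [E|_] /eqP H1 //; have H2 := someI H1; right; exists i.
apply/existsP; case: H => [[E1 E2]|[i E1 E2]].
  by exists ord0; rewrite chart_pos1 // E2.
by exists i; rewrite chart_pos2 // E2.
Qed.

Lemma realizes_beyond p c y i : y \in carrier ->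
  sigma (R (alpha (p, i)).2 (coord y.2)) = R i c -> beyond k l i c.
Proof. by rewrite /beyond carrierE => yc <-; rewrite sreflK in_piece_toside1. Qed.

Lemma realizes_in_piece p c : in_piece k l c -> exists x, coord x = c /\ realizes p c (p, x).
Proof.
move=> pc; have [x E] := tame_box Hkl pc; exists x; split => //.
by apply/realizesP; rewrite carrierE /= E; split => //; left.
Qed.

Lemma realizes_across p i c : beyond k l i c ->
  exists x, sigma (R (alpha (p, i)).2 (coord x)) = R i c
    /\ realizes p c ((alpha (p, i)).1, x).
Proof.
move=> bc; set j := (alpha (p, i)).2.
have [|x E] := @tame_box _ _ Hkl (Rinv j (sigma (R i c))).
  by rewrite -(in_piece_toside1 j) fromside1K.
have E' : sigma (R j (coord x)) = R i c by rewrite E fromside1K sreflK.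
exists x; split => //; apply/realizesP; split; last by right; exists i.
by rewrite carrierE /= -(in_piece_toside1 j) E fromside1K.
Qed.

Lemma glue0_sym (x y : W) : glue0 alpha x y -> glue0 alpha y x.
Proof.
move=> /and3P[xc yc /existsP[i /andP[/eqP E /eqP H]]]; apply/and3P; split => //.
apply/existsP; exists (alpha (x.1, i)).2; rewrite -E -surjective_pairing aK eqxx /=.
by rewrite !chart_pos_alpha H.
Qed.

Lemma glue_sym (x y : W) : glue x y = glue y x.
Proof. by rewrite /Defs.glue orbC. Qed.

Lemma glueP (x y : W) : glue x y -> exists i,
  [/\ x \in carrier, y \in carrier, y.1 = (alpha (x.1, i)).1
    & R i (coord x.2) = sigma (R (alpha (x.1, i)).2 (coord y.2))].
Proof.
move=> H; have : glue0 alpha x y by case/orP: H => // /glue0_sym.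
move=> /and3P[xc yc /existsP[i /andP[/eqP E /eqP]]].
by rewrite chart_pos1 // chart_pos2 // => H1; have H2 := someI H1; exists i.
Qed.

(** A copy in the piece of [p] is glued directly to each copy across a side. Copies across two
    different sides are linked through the piece of [p], which contains [c] by [tame_corner]. *)
Lemma realizes_connect p c y y' :
  realizes p c y -> realizes p c y' -> connect glue y y'.
Proof.
have E1 y1 y2 i : y1 \in carrier -> y1.1 = p -> coord y1.2 = c -> y2 \in carrier ->
    y2.1 = (alpha (p, i)).1 -> sigma (R (alpha (p, i)).2 (coord y2.2)) = R i c ->
    glue y1 y2.
  move=> c1 e1 e2 c2 e3 e4; apply/orP; left; apply/and3P; split => //.
  apply/existsP; exists i; rewrite e1 e3 eqxx chart_pos1 // chart_pos2 //=.
  by rewrite e2 e4.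
move=> /realizesP[yc Hy] /realizesP[yc' Hy'].
case: Hy Hy' => [[e1 e2]|[i e1 e2]] [[e1' e2']|[i' e1' e2']].
- suff -> : y = y' by apply: connect0.
  case: y y' e1 e2 e1' e2' {yc yc'} => p1 c1 [p2 c2] /= -> <- -> E.
  by rewrite (coord_inj E).
- exact/connect1/(E1 _ _ i').
- by rewrite connect1 // glue_sym; apply: (E1 _ _ i).
- have [ii|ni] := eqVneq i i'.
    suff -> : y = y' by apply: connect0.
    subst i'; move: e2'; rewrite -e2 => /(can_inj (@sreflK k l)) /(can_inj (@toside1K k l _)) E.
    case: y y' e1 e1' E {e2 yc yc'} => p1 c1 [p2 c2] /= -> -> E.
    by rewrite (coord_inj E).
  have b := realizes_beyond yc e2; have b' := realizes_beyond yc' e2'.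
  have [x [Ex /realizesP[xc _]]] := realizes_in_piece p (tame_corner Hkl b b' ni).
  apply: (connect_trans (y := (p, x))); rewrite connect1 //; last by apply: (E1 _ _ i').
  by rewrite glue_sym; apply: (E1 _ _ i).
Qed.

Definition has_nbr (x : W) (T : {set W}) : Prop :=
  exists c' y, [/\ tri_adj (coord x.2) c', y \in T & realizes x.1 c' y].

(** Being glued along side [i], the triangle of [x] lies beyond that side, so by [tame_exit] its
    neighbour is in the piece or beyond the same side. Either way one copy of the neighbour is
    visible in the frames of both [x] and [x']. *)
Lemma has_nbr_glue x x' (T : {set W}) : (forall y y', connect glue y y' -> y \in T -> y' \in T) ->
  glue x x' -> has_nbr x T -> has_nbr x' T.
Proof.
move=> clT /glueP[i [xc xc' E1 E2]] [c' [y [adj yT ry]]].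
set j := (alpha (x.1, i)).2 in E2; pose c2 := Rinv j (sigma (R i c')).
have Ec2 : R j c2 = sigma (R i c') by rewrite fromside1K.
have adj2 : tri_adj (coord x'.2) c2.
  by rewrite -(tri_adj_toside1 k l j) -(tri_adj_srefl k l) -E2 Ec2 sreflK tri_adj_toside1.
have aj : alpha (x'.1, j) = (x.1, i) by rewrite E1 -surjective_pairing aK.
have bx : beyond k l i (coord x.2).
  by apply: (realizes_beyond (p := x.1) xc'); rewrite -E2.
rewrite carrierE in xc.
suff [y0 r1 r2] : exists2 y0, realizes x.1 c' y0 & realizes x'.1 c2 y0.
  by exists c2, y0; split=> //; apply: clT yT; apply: realizes_connect ry r1.
have : in_piece k l c' \/ beyond k l i c'.
  by case: (tame_exit Hkl xc adj) => [|[i' [bi' /(_ i bx) ->]]]; [left|right].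
move=> [/(realizes_in_piece x.1)|/(realizes_across x.1)].
  move=> [z [Ez rz]]; exists (x.1, z) => //.
  case/realizesP: rz => zc _; apply/realizesP; split => //; right.
  by exists j; rewrite aj //= Ez Ec2.
move=> [z [Ez rz]]; exists ((alpha (x.1, i)).1, z) => //.
case/realizesP: rz => zc _; apply/realizesP; split => //; left; split => //=.
by apply: (can_inj (@toside1K k l j)); rewrite Ec2 -Ez sreflK.
Qed.
End Local.

(* The translations by [2z] and [2wz] are trivial mod 6 on codes, so this relation *)
(* descends to the Goldberg-Coxeter graph, where it separates neighbours. *)
Definition sim6 (c c' : ipt) : bool :=
  ((c.1 - c'.1) %% 6 == 0)%Z && ((c.2 - c'.2) %% 6 == 0)%Z
  || ((c.1 + c'.1) %% 6 == 0)%Z && ((c.2 + c'.2) %% 6 == 0)%Z.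

Lemma sim6_refl c : sim6 c c.
Proof. by rewrite /sim6 !subrr. Qed.

Lemma sim6_nbr c c' : is_tri c -> c' \in tri_nbrs c -> sim6 c c' = false.
Proof.
move=> /is_triP[a [b E]]; rewrite /tri_nbrs /sim6.
by case: E => -> /=; case: ifP => ?; rewrite !inE => /or3P[] /eqP -> /=; lia.
Qed.

Lemma sim6_nbrs c c' c'' : is_tri c -> c' \in tri_nbrs c -> c'' \in tri_nbrs c ->
  sim6 c' c'' -> c' = c''.
Proof.
move=> /is_triP[a [b E]]; rewrite /tri_nbrs /sim6.
by case: E => -> /=; case: ifP => ?;
  rewrite !inE => /or3P[] /eqP -> /or3P[] /eqP -> //=; lia.
Qed.

(** * Vertices of the Goldberg-Coxeter graph and their neighbourhoods *)

Definition side1 : 'I_3 := @Ordinal 3 1 isT.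

Section Nbhd.
Variables (V : finType) (alpha : V * 'I_3 -> V * 'I_3).
Hypothesis HX : plane_cubic_graph alpha.
Hypothesis H3 : faces_div3 alpha.
Variables (k l : nat).
Hypothesis Hkl : tame k l.
Local Notation D := (V * 'I_3)%type.
Local Notation W := (V * cell k l)%type.
Local Notation carrier := (gc_carrier V k l).
Local Notation glue := (@glue V alpha k l).
Local Notation GCv := (GCvert alpha k l).

Lemma connect_glue_sym : connect_sym glue.
Proof. by apply: sym_connect_sym => x y; rewrite glue_sym. Qed.

Lemma connect_carrier x y : connect glue x y -> x \in carrier -> y \in carrier.
Proof.
move=> cxy; rewrite (closed_connect _ cxy) // => u v /(glueP HX)[i [uc vc _ _]].
by rewrite uc vc.
Qed.

Lemma GCvert_class (S : GCv) x : x \in val S -> x \in carrier /\ val S = gc_class alpha x.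
Proof.
have /imsetP[y yc ->] := valP S; rewrite inE => cyx.
split; first exact: connect_carrier cyx yc.
by apply/setP => u; rewrite !inE (same_connect connect_glue_sym cyx).
Qed.

Lemma GCvert_closed (S : GCv) x y : connect glue x y -> x \in val S -> y \in val S.
Proof. by move=> cxy /GCvert_class[_ ->]; rewrite inE. Qed.

Lemma GCvert_eq (S T : GCv) x : x \in val S -> x \in val T -> S = T.
Proof. by move=> /GCvert_class[_ ES] /GCvert_class[_ ET]; apply: val_inj; rewrite ES ET. Qed.

Lemma GCvert_ex (S : GCv) : exists x, x \in val S.
Proof. by have /imsetP[y _ ->] := valP S; exists y; rewrite inE connect0. Qed.

Definition rep (S : GCv) : W := xchoose (GCvert_ex S).

Lemma mem_rep S : rep S \in val S. Proof. exact: xchooseP. Qed.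

Lemma gc_adj_sym : symmetric (@gc_adj V alpha k l).
Proof.
have H S T : gc_adj S T -> gc_adj T S.
  move=> /andP[n /existsP[d /exists_inP[x xS /exists_inP[y yT H]]]].
  rewrite /gc_adj eq_sym n; apply/existsP; exists d; apply/exists_inP; exists y => //.
  apply/exists_inP; exists x => //; move: H; rewrite /chart_adj.
  by case: chart_pos => // a; case: chart_pos => // b; rewrite nbvecs_opp.
by move=> S T; apply/idP/idP; apply: H.
Qed.

(** [has_nbr_glue] carries a witness of adjacency along a chain of gluings, so neighbours can be
    read off at any single representative [x]. *)
Lemma gc_adjP (S T : GCv) x : x \in val S ->
  reflect (S <> T /\ has_nbr alpha x (val T)) (gc_adj S T).
Proof.
move=> xS; apply: (iffP andP) => -[n H]; split.
- by move=> E; rewrite E eqxx in n.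
- move: H => /existsP[d /exists_inP[x' x'S /exists_inP[y yT H]]].
  have [xc _] := GCvert_class x'S; have [yc _] := GCvert_class yT.
  have {}H : has_nbr alpha x' (val T).
    have {H}[d' E H] : exists2 d', x'.1 = d'.1 & chart_adj alpha d' x' y.
      have [E|n1] := eqVneq x'.1 d.1; first by exists d.
      have [E|n2] := eqVneq x'.1 (alpha d).1.
        exists (alpha d) => //; move: H; rewrite /chart_adj !(chart_pos_alpha HX).
        by case: chart_pos => // a; case: chart_pos => //= b; rewrite nbvecs_srefl.
      by move: H; rewrite /chart_adj /chart_pos (negPf n1) (negPf n2).
    move: H; rewrite /chart_adj (chart_pos1 _ E).
    case Ey : chart_pos => [b|] // Hb.
    have ry : realizes alpha x'.1 (fromside1 k l d'.2 b) y.
      rewrite /realizes yc; apply/existsP; exists d'.2.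
      by rewrite fromside1K E -surjective_pairing Ey.
    exists (fromside1 k l d'.2 b), y; split => //.
    rewrite -(tri_adj_toside1 k l d'.2) fromside1K /tri_adj Hb andbT.
    have tri i (z : W) : z \in carrier -> is_tri (toside1 k l i (coord z.2)).
      by rewrite carrierE -(in_piece_toside1 Hkl i) => /andP[].
    rewrite tri //=; move: Ey; rewrite /chart_pos.
    case: (y.1 =P d'.1) => _; [|case: (y.1 =P (alpha d').1) => _ //].
      by move=> [<-]; apply: (tri d'.2 y yc).
    by move=> [<-]; rewrite is_tri_srefl; apply: (tri _ y yc).
  have /connectP[p] : connect glue x' x.
    by move: (xS); have [_ ->] := GCvert_class x'S; rewrite inE.
  elim: p x' H {x'S xc} => [|z p IH] u Hu /=; first by move=> _ ->.
  move=> /andP[guz pz] E; apply: (IH z) => //.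
  by apply: has_nbr_glue Hu => // ? ?; apply: GCvert_closed.
- by apply/eqP => /val_inj.
- case: H => c' [y [/and3P[_ _ adj] yT /andP[yc /existsP[i /eqP E]]]].
  apply/existsP; exists (x.1, i); apply/exists_inP; exists x => //.
  apply/exists_inP; exists y => //; rewrite /chart_adj E chart_pos1 //.
  rewrite /toside1; by elim: (rotidx _) => //= m IH; rewrite nbvecs_rho.
Qed.

Section Value.
Variables (A : Type) (Fd : D -> ipt -> A).
Hypothesis Fr : forall d u, Fd (rot d) u = Fd d (rho k l u).
Hypothesis Fa : forall d u, Fd (alpha d) u = Fd d (srefl k l u).

Definition cellval (x : W) : A := Fd (x.1, side1) (coord x.2).
Definition vertval (S : GCv) : A := cellval (rep S).

(** At [side1] no rotation is applied, so this dart carries the standard frame of a piece, the one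
    used by [cellval]. *)
Lemma Fd_toside1 d u : Fd d (toside1 k l d.2 u) = Fd (d.1, side1) u.
Proof.
case: d => p [[|[|[|i]]] lti] //; rewrite /toside1 /= -?Fr; congr (Fd _ u); congr pair;
  exact: val_inj.
Qed.

Lemma cellval_realizes p c y : realizes alpha p c y -> cellval y = Fd (p, side1) c.
Proof.
move=> /(realizesP HX)[_ [[<- <-] //|[i E1 E2]]].
rewrite /cellval E1 -Fd_toside1 Fa E2.
exact: (Fd_toside1 (p, i)).
Qed.

Lemma cellval_glue x y : connect glue x y -> cellval x = cellval y.
Proof.
move=> cxy; have := @closed_connect _ glue [pred u | `[< cellval u = cellval x >]] _ _ _ cxy.
rewrite !inE => E; apply/esym/asboolP; rewrite -E; first exact/asboolP.
move=> u v /(glueP HX)[i [uc vc E1 E2]]; rewrite !inE.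
suff -> : cellval u = cellval v by [].
by rewrite /cellval -(Fd_toside1 (u.1, i)) E2 -Fa Fd_toside1 E1.
Qed.

Lemma vertvalE (S : GCv) x : x \in val S -> vertval S = cellval x.
Proof.
by move=> xS; apply: cellval_glue; have [_ E] := GCvert_class (mem_rep S); rewrite E inE in xS.
Qed.
End Value.

(** Developing a predicate-valued function records the class of the lattice position itself, which
    tells vertices apart. *)
Let sim6_frames d0 : exists Fd : D -> ipt -> (ipt -> bool),
  [/\ forall d u, Fd (rot d) u = Fd d (rho k l u),
      forall d u, Fd (alpha d) u = Fd d (srefl k l u)
    & Fd d0 =1 sim6].
Proof.
apply: (frames HX H3) => [a b|m n a b]; apply: funext => -[x y]; rewrite /sim6 /=.
  by rewrite orbC; congr (_ && _ || _ && _); apply/idP/idP; lia.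
have E (u v w : int) : u = v + 6 * w -> ((u %% 6)%Z == 0) = ((v %% 6)%Z == 0) by lia.
congr (_ && _ || _ && _); apply: E.
- by instantiate (1 := m * k%:Z - n * l%:Z); ring.
- by instantiate (1 := m * l%:Z + n * (k + l)%:Z); ring.
- by instantiate (1 := m * k%:Z - n * l%:Z); ring.
- by instantiate (1 := m * l%:Z + n * (k + l)%:Z); ring.
Qed.

(** Each lattice neighbour of [x] has a copy by [tame_exit], and [sim6_frames] separates these
    copies from one another and from [S]. As [Ts] does not depend on [Fd], sums over neighbours
    become lattice sums for every compatible family. *)
Lemma GC_nbhd (S : GCv) x : x \in val S -> exists Ts : seq GCv,
  [/\ uniq Ts, Ts =i gc_adj S
    & forall A (Fd : D -> ipt -> A),
        (forall d u, Fd (rot d) u = Fd d (rho k l u)) ->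
        (forall d u, Fd (alpha d) u = Fd d (srefl k l u)) ->
        map (vertval Fd) Ts = map (Fd (x.1, side1)) (tri_nbrs (coord x.2))].
Proof.
move=> xS; have [xc _] := GCvert_class xS; rewrite carrierE in xc.
have tc : is_tri (coord x.2) by case/andP: xc.
(* The defaults, [x] here and [S] in [T], are never taken at lattice neighbours of [x]. *)
pose Y c' := odflt x [pick y | realizes alpha x.1 c' y].
have YP c' : c' \in tri_nbrs (coord x.2) -> realizes alpha x.1 c' (Y c').
  rewrite mem_tri_nbrs // /Y => adj; case: pickP => //= none.
  case: (tame_exit Hkl xc adj) => [/(realizes_in_piece HX Hkl x.1)[z [_ rz]]|[i [+ _]]].
    by rewrite none in rz.
  by move=> /(realizes_across HX Hkl x.1)[z [_ rz]]; rewrite none in rz.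
pose T c' : GCv := insubd S (gc_class alpha (Y c')).
have TY c' : c' \in tri_nbrs (coord x.2) -> Y c' \in val (T c').
  move=> /YP /andP[yc _]; rewrite val_insubd.
  by rewrite (imset_f (@gc_class V alpha k l) yc) inE connect0.
have val_T A (Fd : D -> ipt -> A) c' : (forall d u, Fd (rot d) u = Fd d (rho k l u)) ->
    (forall d u, Fd (alpha d) u = Fd d (srefl k l u)) ->
    c' \in tri_nbrs (coord x.2) -> vertval Fd (T c') = Fd (x.1, side1) c'.
  move=> Fr Fa nc; rewrite (vertvalE Fr Fa (TY _ nc)).
  exact: (cellval_realizes Fr Fa (YP _ nc)).
have [Fd [Fr Fa F0]] := sim6_frames (x.1, side1).
exists (map T (tri_nbrs (coord x.2))); split.
- rewrite map_inj_in_uniq ?tri_nbrs_uniq // => c' c'' n' n'' E.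
  apply: (sim6_nbrs tc n' n''); rewrite -F0 -(val_T _ _ _ Fr Fa n') E.
  by rewrite (val_T _ _ _ Fr Fa n'') F0 sim6_refl.
- move=> U; rewrite [RHS]unfold_in; apply/mapP/(gc_adjP _ xS).
    move=> [c' nc ->]; split.
      move=> E; have := sim6_nbr tc nc; rewrite -F0.
      have := vertvalE Fr Fa xS; rewrite {1}E (val_T _ _ _ Fr Fa nc) /cellval => <-.
      by rewrite F0 sim6_refl.
    by exists c', (Y c'); rewrite -mem_tri_nbrs //; split; [|exact: TY|exact: YP].
  move=> [_ [c' [y [adj yU ry]]]]; have nc : c' \in tri_nbrs (coord x.2) by rewrite mem_tri_nbrs.
  exists c' => //; apply: (GCvert_eq yU).
  exact: (GCvert_closed (realizes_connect HX Hkl (YP _ nc) ry) (TY _ nc)).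
- move=> A G Gr Ga; rewrite -map_comp; apply/eq_in_map => c' nc.
  exact: val_T.
Qed.
End Nbhd.

(** * Pieces for l = 0 and l = k *)

Lemma open_up_triP a b (W : qpt) :
  let c := (3 * a + 1, 3 * b + 1) in
  in_open_tri (toQ (tri_verts c).1.1) (toQ (tri_verts c).1.2) (toQ (tri_verts c).2) W
  = [&& a%:~R < W.1, b%:~R < W.2 & W.1 + W.2 < a%:~R + b%:~R + 1].
Proof.
case: W => x y; rewrite /tri_verts /=.
have -> : ((3 * a + 1) %% 3)%Z == 1 by lia.
have -> : ((3 * a + 1 - 1) %/ 3)%Z = a by lia.
have -> : ((3 * b + 1 - 1) %/ 3)%Z = b by lia.
rewrite /in_open_tri /orient /toQ /= !intrD.
by apply/idP/idP => /and3P[h1 h2 h3]; apply/and3P; split; lra.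
Qed.

Lemma open_down_triP a b (W : qpt) :
  let c := (3 * a + 2, 3 * b + 2) in
  in_open_tri (toQ (tri_verts c).1.1) (toQ (tri_verts c).1.2) (toQ (tri_verts c).2) W
  = [&& W.1 < a%:~R + 1, W.2 < b%:~R + 1 & a%:~R + b%:~R + 1 < W.1 + W.2].
Proof.
case: W => x y; rewrite /tri_verts /=.
have -> : ((3 * a + 2) %% 3)%Z == 1 = false by lia.
have -> : ((3 * a + 2 - 2) %/ 3)%Z = a by lia.
have -> : ((3 * b + 2 - 2) %/ 3)%Z = b by lia.
rewrite /in_open_tri /orient /toQ /= !intrD.
by apply/idP/idP => /and3P[h1 h2 h3]; apply/and3P; split; lra.
Qed.

Lemma open_side_k0 k (W : qpt) : (0 < k)%N ->
  in_open_tri (toQ (0, 0)) (toQ (Tz k 0)) (toQ (Twz k 0)) W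
  = [&& 0 < W.2, W.1 + W.2 < k%:R & 0 < W.1].
Proof.
move=> k0; have k1 : (0 : rat) < k%:R by rewrite ltr0n.
case: W => x y; rewrite /in_open_tri /orient /toQ /Tz /Twz /= addn0 oppr0 !mulr0z -!pmulrn.
congr [&& _, _ & _].
- by rewrite -[RHS](pmulr_rgt0 _ k1); congr (0 < _); ring.
- by rewrite -[RHS]subr_gt0 -[RHS](pmulr_rgt0 _ k1); congr (0 < _); ring.
- by rewrite -[RHS](pmulr_rgt0 _ k1); congr (0 < _); ring.
Qed.

Lemma open_side_kk k (W : qpt) : (0 < k)%N ->
  in_open_tri (toQ (0, 0)) (toQ (Tz k k)) (toQ (Twz k k)) W
  = [&& W.1 < W.2, W.1 + 2 * W.2 < 3 * k%:R & 0 < W.2 + 2 * W.1].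
Proof.
move=> k0; have k1 : (0 : rat) < k%:R by rewrite ltr0n.
case: W => x y; rewrite /in_open_tri /orient /toQ /Tz /Twz /= mulrNz -!pmulrn natrD.
congr [&& _, _ & _].
- by rewrite -[RHS]subr_gt0 -[RHS](pmulr_rgt0 _ k1); congr (0 < _); ring.
- by rewrite -[RHS]subr_gt0 -[RHS](pmulr_rgt0 _ k1); congr (0 < _); ring.
- by rewrite -[RHS](pmulr_rgt0 _ k1); congr (0 < _); ring.
Qed.

Lemma is_tri_up a b : is_tri (3 * a + 1, 3 * b + 1).
Proof. by apply/is_triP; exists a, b; left. Qed.

Lemma is_tri_down a b : is_tri (3 * a + 2, 3 * b + 2).
Proof. by apply/is_triP; exists a, b; right. Qed.

(* Barycenter in the closed triangle [T]; for other [l] this would not *)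
(* characterize the triangles meeting the interior of [T]. *)
Definition closed_k0 (k : nat) (c : ipt) : bool :=
  [&& 0 <= c.1, 0 <= c.2 & c.1 + c.2 <= 3 * k%:Z].

Definition closed_kk (k : nat) (c : ipt) : bool :=
  [&& c.1 <= c.2, 2 * c.2 + c.1 <= 9 * k%:Z & 0 <= c.2 + 2 * c.1].

Lemma piece_k0 k c : (0 < k)%N -> in_piece k 0 c = is_tri c && closed_k0 k c.
Proof.
move=> k0; rewrite /in_piece; case: (boolP (is_tri c)) => //= /is_triP[a [b E]].
apply/asboolP/idP.
  move=> [W /andP[]]; rewrite open_side_k0 //; case: E => ->.
    rewrite open_up_triP => /and3P[h1 h2 h3] /and3P[h4 h5 h6].
    have : (0 : rat) < (a + 1)%:~R by rewrite intrD; lra.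
    have : (0 : rat) < (b + 1)%:~R by rewrite intrD; lra.
    have : (a + b)%:~R < k%:Z%:~R :> rat by rewrite intrD; lra.
    by rewrite !ltr0z ltr_int /closed_k0 /=; lia.
  rewrite open_down_triP => /and3P[h1 h2 h3] /and3P[h4 h5 h6].
  have : (0 : rat) < (a + 1)%:~R by rewrite intrD; lra.
  have : (0 : rat) < (b + 1)%:~R by rewrite intrD; lra.
  have : (a + b + 1)%:~R < k%:Z%:~R :> rat by rewrite !intrD; lra.
  by rewrite !ltr0z ltr_int /closed_k0 /=; lia.
have le_rat (x y : int) : x <= y -> x%:~R <= y%:~R :> rat by rewrite ler_int.
case: E => -> /and3P[/= h1 h2 h3].
  exists (a%:~R + 1 / 3, b%:~R + 1 / 3); rewrite open_side_k0 // open_up_triP /=.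
  have := le_rat 0 a; have := le_rat 0 b; have := le_rat (a + b + 1) k%:Z.
  rewrite !intrD => H1 H2 H3.
  have {}H1 := H1 ltac:(lia); have {}H2 := H2 ltac:(lia); have {}H3 := H3 ltac:(lia).
  by apply/andP; split; apply/and3P; split; lra.
exists (a%:~R + 2 / 3, b%:~R + 2 / 3); rewrite open_side_k0 // open_down_triP /=.
have := le_rat 0 a; have := le_rat 0 b; have := le_rat (a + b + 2) k%:Z.
rewrite !intrD => H1 H2 H3.
have {}H1 := H1 ltac:(lia); have {}H2 := H2 ltac:(lia); have {}H3 := H3 ltac:(lia).
by apply/andP; split; apply/and3P; split; lra.
Qed.

Lemma piece_kk k c : (0 < k)%N -> in_piece k k c = is_tri c && closed_kk k c.
Proof.
move=> k0; rewrite /in_piece; case: (boolP (is_tri c)) => //= /is_triP[a [b E]].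
apply/asboolP/idP.
  move=> [W /andP[]]; rewrite open_side_kk //; case: E => ->.
    rewrite open_up_triP => /and3P[h1 h2 h3] /and3P[h4 h5 h6].
    have : (0 : rat) < (b - a + 1)%:~R by rewrite !(intrD, mulrNz); lra.
    have : (0 : rat) < (b + 2 * a + 2)%:~R by rewrite !(intrD, intrM); lra.
    have : (a + 2 * b)%:~R < (3 * k%:Z)%:~R :> rat by rewrite !(intrD, intrM); lra.
    by rewrite !ltr0z ltr_int /closed_kk /=; lia.
  rewrite open_down_triP => /and3P[h1 h2 h3] /and3P[h4 h5 h6].
  have : (0 : rat) < (b - a + 1)%:~R by rewrite !(intrD, mulrNz); lra.
  have : (0 : rat) < (b + 2 * a + 3)%:~R by rewrite !(intrD, intrM); lra.
  have : (a + 2 * b + 1)%:~R < (3 * k%:Z)%:~R :> rat by rewrite !(intrD, intrM); lra.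
  by rewrite !ltr0z ltr_int /closed_kk /=; lia.
have le_rat (x y : int) : x <= y -> x%:~R <= y%:~R :> rat by rewrite ler_int.
(* A triangle cut by a side has its barycenter on it, so the witness is moved *)
(* off the barycenter into the piece. *)
have up u v (p q r : int) :
    0 < u :> rat -> 0 < v :> rat -> u + v < 1 ->
    p <= b - a -> q <= b + 2 * a -> r <= 3 * k%:Z - a - 2 * b ->
    0 < p%:~R + v - u -> 0 < q%:~R + v + 2 * u -> 0 < r%:~R - u - 2 * v ->
    c = (3 * a + 1, 3 * b + 1) -> meets_int k k c.
  move=> u0 v0 uv /le_rat + /le_rat + /le_rat + + + + ->.
  rewrite !(intrD, mulrNz, intrM) => p1 q1 r1 p2 q2 r2.
  exists (a%:~R + u, b%:~R + v); rewrite open_side_kk // open_up_triP /=.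
  by apply/andP; split; apply/and3P; split; lra.
have down u v (p q r : int) :
    0 < u :> rat -> 0 < v :> rat -> u + v < 1 ->
    p <= b - a -> q <= b + 2 * a + 3 -> r <= 3 * k%:Z - a - 2 * b - 3 ->
    0 < p%:~R + u - v -> 0 < q%:~R - v - 2 * u -> 0 < r%:~R + u + 2 * v ->
    c = (3 * a + 2, 3 * b + 2) -> meets_int k k c.
  move=> u0 v0 uv /le_rat + /le_rat + /le_rat + + + + ->.
  rewrite !(intrD, mulrNz, intrM) => p1 q1 r1 p2 q2 r2.
  exists (a%:~R + 1 - u, b%:~R + 1 - v); rewrite open_side_kk // open_down_triP /=.
  by apply/andP; split; apply/and3P; split; lra.
case: E => Ec; rewrite Ec => /and3P[/= h1 h2 h3]; rewrite -Ec.
  (* The first three cases have the barycenter on side 0, 2, 1 of [T]; in the last it is interior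
     and is itself the witness. *)
  have [e|ne] := eqVneq a b.
    by apply: (up (1 / 4) (1 / 2) 0 0 3) ; [lra|lra|lra|lia|lia|lia|lra|lra|lra|exact: Ec].
  have [e'|ne'] := eqVneq (b + 2 * a + 1) 0.
    by apply: (up (1 / 2) (1 / 4) 1 (-1) 2) ; [lra|lra|lra|lia|lia|lia|lra|lra|lra|exact: Ec].
  have [e''|ne''] := eqVneq (a + 2 * b + 1) (3 * k%:Z).
    by apply: (up (1 / 4) (1 / 4) 1 0 1) ; [lra|lra|lra|lia|lia|lia|lra|lra|lra|exact: Ec].
  by apply: (up (1 / 3) (1 / 3) 1 0 2) ; [lra|lra|lra|lia|lia|lia|lra|lra|lra|exact: Ec].
have [e|ne] := eqVneq a b.
  by apply: (down (1 / 2) (1 / 4) 0 3 0) ; [lra|lra|lra|lia|lia|lia|lra|lra|lra|exact: Ec].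
have [e'|ne'] := eqVneq (b + 2 * a + 2) 0.
  by apply: (down (1 / 4) (1 / 4) 1 1 0) ; [lra|lra|lra|lia|lia|lia|lra|lra|lra|exact: Ec].
have [e''|ne''] := eqVneq (a + 2 * b + 2) (3 * k%:Z).
  by apply: (down (1 / 4) (1 / 2) 1 2 (-1)) ; [lra|lra|lra|lia|lia|lia|lra|lra|lra|exact: Ec].
by apply: (down (1 / 3) (1 / 3) 1 2 0) ; [lra|lra|lra|lia|lia|lia|lra|lra|lra|exact: Ec].
Qed.

Lemma is_tri_toside1 k l i c : is_tri (toside1 k l i c) = is_tri c.
Proof. by rewrite /toside1; elim: (rotidx i) => //= n; rewrite is_tri_rho. Qed.

Lemma coord_box k l (x y : int) :
  - (boxO k l)%:Z <= x <= (boxO k l)%:Z -> - (boxO k l)%:Z <= y <= (boxO k l)%:Z ->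
  exists c : cell k l, coord c = (x, y).
Proof.
set B := boxO k l => hx hy.
have Hx : (`|(x + B%:Z)%R|%N < (2 * B).+1)%N by lia.
have Hy : (`|(y + B%:Z)%R|%N < (2 * B).+1)%N by lia.
by exists (Ordinal Hx, Ordinal Hy); rewrite /Defs.coord /= -/B; congr pair; lia.
Qed.

Lemma tri_adjP c c' : tri_adj c c' -> is_tri c' /\ exists a b,
  (c.1 = 3 * a + 1 /\ c.2 = 3 * b + 1 /\
    (c'.1 = 3 * a + 2 /\ c'.2 = 3 * b + 2 \/ c'.1 = 3 * a - 1 /\ c'.2 = 3 * b + 2
     \/ c'.1 = 3 * a + 2 /\ c'.2 = 3 * b - 1))
  \/ (c.1 = 3 * a + 2 /\ c.2 = 3 * b + 2 /\
    (c'.1 = 3 * a + 1 /\ c'.2 = 3 * b + 1 \/ c'.1 = 3 * a + 4 /\ c'.2 = 3 * b + 1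
     \/ c'.1 = 3 * a + 1 /\ c'.2 = 3 * b + 4)).
Proof.
move=> adj; have /and3P[tc tc' _] := adj; split=> //.
move: adj; rewrite -mem_tri_nbrs //; have /is_triP[a [b E]] := tc.
by rewrite /tri_nbrs => n; exists a, b; case: E n => -> /=; case: ifP => ?;
  rewrite !inE => /or3P[] /eqP -> /=; lia.
Qed.

Lemma tame_k0 k : (0 < k)%N -> tame k 0.
Proof.
move=> k0; have P c := piece_k0 c k0.
(* [b0], [b1], [b2] are the closed triangles glued to [T] along sides 0, 1, 2. *)
pose b0 (c : ipt) := [&& c.2 <= 0, 0 <= c.1 + c.2 & c.1 <= 3 * k%:Z].
pose b1 (c : ipt) := [&& 3 * k%:Z <= c.1 + c.2, c.1 <= 3 * k%:Z & c.2 <= 3 * k%:Z].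
pose b2 (c : ipt) := [&& c.1 <= 0, 0 <= c.1 + c.2 & c.2 <= 3 * k%:Z].
have B i c : beyond k 0 i c = is_tri c && nth b0 [:: b0; b1; b2] i c.
  rewrite /beyond P is_tri_srefl is_tri_toside1; congr (_ && _).
  case: c i => x y [[|[|[|i]]] lti] //=;
    rewrite /toside1 /closed_k0 /srefl /rho /mulw2 /b0 /b1 /b2 /=;
    by apply/and3P/and3P => -[h1 h2 h3]; split; lia.
split.
- move=> c c'; rewrite !P => /andP[tc /and3P[p1 p2 p3]] /tri_adjP[tc' [a [b nb]]]; rewrite tc' /=.
  have nob i j : beyond k 0 j c -> j = i.
    rewrite B tc; case: j => -[|[|[|j]]] //= ltj; rewrite /b0 /b1 /b2;
    by move=> /and3P[h4 h5 h6]; exfalso; lia.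
  have [h0|h0] := ltP c'.2 0.
    right; exists (@Ordinal 3 0 isT); split; last exact: nob.
    by rewrite B tc' /=; apply/and3P; split; lia.
  have [h1|h1] := ltP (3 * k%:Z) (c'.1 + c'.2).
    right; exists (@Ordinal 3 1 isT); split; last exact: nob.
    by rewrite B tc' /=; apply/and3P; split; lia.
  have [h2|h2] := ltP c'.1 0.
    right; exists (@Ordinal 3 2 isT); split; last exact: nob.
    by rewrite B tc' /=; apply/and3P; split; lia.
  by left; apply/and3P.
- move=> i j c; rewrite !B P => /andP[tc bi] /andP[_ bj] nij; rewrite tc /=.
  case: i j bi bj nij => -[|[|[|i]]] ? [[|[|[|j]]] ?] //= /and3P[h1 h2 h3] /and3P[h4 h5 h6] _;
    by apply/and3P; split; lia.
- move=> [x y]; rewrite P => /andP[_ /and3P[/= h1 h2 h3]].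
  by apply: coord_box; rewrite /boxO; lia.
- move=> [x y]; rewrite !P is_tri_rho; congr (_ && _).
  by rewrite /closed_k0 /rho /mulw2 /=; apply/and3P/and3P => -[h1 h2 h3]; split; lia.
Qed.

(** The sides now run through barycenters: a triangle cut by a side is both in the piece and beyond
    that side, and a step out of the piece from it crosses this very side. *)
Lemma tame_kk k : (0 < k)%N -> tame k k.
Proof.
move=> k0; have P c := piece_kk c k0.
pose b0 (c : ipt) := [&& c.2 <= c.1, 0 <= 2 * c.2 + c.1 & c.2 + 2 * c.1 <= 9 * k%:Z].
pose b1 (c : ipt) := [&& 9 * k%:Z <= 2 * c.2 + c.1, c.2 - c.1 <= 9 * k%:Z & c.2 + 2 * c.1 <= 9 * k%:Z].
pose b2 (c : ipt) := [&& c.2 + 2 * c.1 <= 0, 0 <= 2 * c.2 + c.1 & c.2 - c.1 <= 9 * k%:Z].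
have B i c : beyond k k i c = is_tri c && nth b0 [:: b0; b1; b2] i c.
  rewrite /beyond P is_tri_srefl is_tri_toside1; congr (_ && _).
  case: c i => x y [[|[|[|i]]] lti] //=;
    rewrite /toside1 /closed_kk /srefl /rho /mulw2 /b0 /b1 /b2 /=;
    by apply/and3P/and3P => -[h1 h2 h3]; split; lia.
split.
- move=> c c'; rewrite !P => /andP[tc /and3P[p1 p2 p3]] /tri_adjP[tc' [a [b nb]]]; rewrite tc' /=.
  have [h0|h0] := ltP c'.2 c'.1.
    right; exists (@Ordinal 3 0 isT); split; first by rewrite B tc' /=; apply/and3P; split; lia.
    move=> j; rewrite B tc; case: j => -[|[|[|j]]] //= ltj /and3P[h4 h5 h6];
      [exact: val_inj|exfalso; lia..].
  have [h1|h1] := ltP (9 * k%:Z) (2 * c'.2 + c'.1).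
    right; exists (@Ordinal 3 1 isT); split; first by rewrite B tc' /=; apply/and3P; split; lia.
    move=> j; rewrite B tc; case: j => -[|[|[|j]]] //= ltj /and3P[h4 h5 h6];
      [exfalso; lia|exact: val_inj|exfalso; lia].
  have [h2|h2] := ltP (c'.2 + 2 * c'.1) 0.
    right; exists (@Ordinal 3 2 isT); split; first by rewrite B tc' /=; apply/and3P; split; lia.
    move=> j; rewrite B tc; case: j => -[|[|[|j]]] //= ltj /and3P[h4 h5 h6];
      [exfalso; lia..|exact: val_inj].
  by left; apply/and3P.
- move=> i j c; rewrite !B P => /andP[tc bi] /andP[_ bj] nij; rewrite tc /=.
  case: i j bi bj nij => -[|[|[|i]]] ? [[|[|[|j]]] ?] //= /and3P[h1 h2 h3] /and3P[h4 h5 h6] _;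
    by apply/and3P; split; lia.
- move=> [x y]; rewrite P => /andP[_ /and3P[/= h1 h2 h3]].
  by apply: coord_box; rewrite /boxO; lia.
- move=> [x y]; rewrite !P is_tri_rho; congr (_ && _).
  by rewrite /closed_kk /rho /mulw2 /=; apply/and3P/and3P => -[h1 h2 h3]; split; lia.
Qed.

(** * Eigenfunctions *)

(** [eigenspace] concerns row vectors; symmetry of the adjacency lets the neighbour sum be read
    along a column. *)
Lemma lap_mult_ge (G : sgraph) (a : algC) n (h : 'I_n -> sv G -> algC) (pt : 'I_n -> sv G) :
  symmetric (@sadj G) ->
  (forall i v, (sdeg v)%:R * h i v - \sum_(u | sadj v u) h i u = a * h i v) ->
  (forall i j, h i (pt j) = (i == j)%:R) -> (n <= lap_mult G a)%N.
Proof.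
move=> sym eig dual; pose U : 'M[algC]_(n, #|sv G|) := \matrix_(i, j) h i (enum_val j).
have rU : (n <= \rank U)%N.
  by apply: (@rank_ge_dual _ _ _ _ pt) => i j; rewrite mxE enum_rankK.
apply: leq_trans rU _; apply: mxrankS; apply/eigenspaceP.
apply/matrixP => i t; rewrite !mxE -eig.
have -> : \sum_(u | sadj (enum_val t) u) h i u
    = \sum_(s < #|sv G|) h i (enum_val s) * (sadj (enum_val s) (enum_val t) : nat)%:R.
  rewrite big_mkcond (reindex (@enum_val (sv G) (sv G))) /=; last first.
    by exists enum_rank => x _; rewrite ?enum_rankK ?enum_valK.
  by apply: eq_bigr => s _; rewrite sym; case: sadj; rewrite ?mulr1 ?mulr0.
under eq_bigr do rewrite !mxE mulrBr.
rewrite sumrB; congr (_ - _); rewrite (bigD1 t) //= eqxx mulrC big1 ?addr0 // => s /negPf ->.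
by rewrite mulr0.
Qed.

Definition tri_eigen (e : algC) (G : ipt -> algC) : Prop :=
  forall c, is_tri c -> \sum_(c' <- tri_nbrs c) G c' = e * G c.

Lemma tri_eigen_rho k l e G : tri_eigen e G -> tri_eigen e (G \o rho k l).
Proof.
move=> H c tc; rewrite /= -H ?is_tri_rho // -(big_map (rho k l) xpredT G).
apply: perm_big; apply: uniq_perm; rewrite ?tri_nbrs_uniq //.
  by rewrite map_inj_uniq ?tri_nbrs_uniq //;
    apply: (can_inj (g := rho k l \o rho k l)) => u; apply: rhoK3.
move=> u; rewrite mem_tri_nbrs ?is_tri_rho //; apply/mapP/idP => [[v]|adj].
  by rewrite mem_tri_nbrs // => adj ->; rewrite tri_adj_rho.
by exists (rho k l (rho k l u)); rewrite ?rhoK3 // mem_tri_nbrs // -(tri_adj_rho k l) rhoK3.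
Qed.

Lemma tri_eigen_srefl k l e G : tri_eigen e G -> tri_eigen e (G \o srefl k l).
Proof.
move=> H c tc; rewrite /= -H ?is_tri_srefl // -(big_map (srefl k l) xpredT G).
apply: perm_big; apply: uniq_perm; rewrite ?tri_nbrs_uniq //.
  by rewrite map_inj_uniq ?tri_nbrs_uniq //; apply: (can_inj (@sreflK k l)).
move=> u; rewrite mem_tri_nbrs ?is_tri_srefl //; apply/mapP/idP => [[v]|adj].
  by rewrite mem_tri_nbrs // => adj ->; rewrite tri_adj_srefl.
by exists (srefl k l u); rewrite ?sreflK // mem_tri_nbrs // -(tri_adj_srefl k l) sreflK.
Qed.

(** * Transfer of lattice eigenfunctions to the Goldberg-Coxeter graph *)

Section Transfer.
Variables (V : finType) (alpha : V * 'I_3 -> V * 'I_3).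
Hypothesis HX : plane_cubic_graph alpha.
Hypothesis H3 : faces_div3 alpha.
Variables (k l : nat).
Hypothesis Hkl : tame k l.
Local Notation D := (V * 'I_3)%type.

(** Passing to [rot d] or [alpha d] composes with a lattice automorphism, so being an eigenfunction
    is a truth value to which [dart_const] applies. *)
Lemma frame_eigen e (Fd : D -> ipt -> algC) d0 :
  (forall d u, Fd (rot d) u = Fd d (rho k l u)) ->
  (forall d u, Fd (alpha d) u = Fd d (srefl k l u)) ->
  tri_eigen e (Fd d0) -> forall d, tri_eigen e (Fd d).
Proof.
move=> Fr Fa E0 d; have aK : involutive alpha by case: HX.
have Er d1 : Fd (rot d1) = Fd d1 \o rho k l by apply: funext => u; apply: Fr.
have Ea d1 : Fd (alpha d1) = Fd d1 \o srefl k l by apply: funext => u; apply: Fa.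
have ha d1 : tri_eigen e (Fd d1) -> tri_eigen e (Fd (alpha d1)).
  by rewrite Ea; apply: tri_eigen_srefl.
have hr d1 : tri_eigen e (Fd d1) -> tri_eigen e (Fd (rot d1)).
  by rewrite Er; apply: tri_eigen_rho.
have ga d1 : `[< tri_eigen e (Fd (alpha d1)) >] = `[< tri_eigen e (Fd d1) >].
  by apply: asbool_equiv_eq; split => [/ha|/ha //]; rewrite aK.
have gr d1 : `[< tri_eigen e (Fd (rot d1)) >] = `[< tri_eigen e (Fd d1) >].
  by apply: asbool_equiv_eq; split => [/hr/hr|/hr //]; rewrite rotK3.
have gf d1 : `[< tri_eigen e (Fd (facep alpha d1)) >] = `[< tri_eigen e (Fd d1) >].
  by rewrite /facep gr ga.
have E := dart_const HX ga gf d d0.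
by apply/asboolP; rewrite E asboolT.
Qed.

(** All [F i] are developed from one dart, so their values at copies of the [c j] are kept and
    duality survives. A test triangle may lie in the base piece or in the one glued along side 1. *)
Lemma GC_mult_ge e n (F : 'I_n -> ipt -> algC) (c : 'I_n -> ipt) :
  (forall i a b, F i (- a, - b) = F i (a, b)) ->
  (forall i (m p : int) a b,
     F i (a + 6 * m * k%:Z - 6 * p * l%:Z, b + 6 * m * l%:Z + 6 * p * (k + l)%:Z)
     = F i (a, b)) ->
  (forall i, tri_eigen e (F i)) ->
  (forall j, in_piece k l (c j) || in_piece k l (srefl k l (c j))) ->
  (forall i j, F i (c j) = (i == j)%:R) ->
  (n <= lap_mult (GC alpha k l) (3%:R - e)%R)%N.
Proof.
move=> FN FT Fe cP dual.
(* A base vertex exists: without vertices Euler's formula would read [0 = nedges + 2]. *)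
have [p0 _|V0] := pickP (@predT V); last first.
  have cV : #|V| = 0%N.
    by apply/eqP; rewrite -leqn0 leqNgt; apply/card_gt0P => -[p _]; have := V0 p.
  have : (nfaces alpha <= #|{: D}|)%N by apply: leq_trans (leq_imset_card _ _) _; apply: max_card.
  by case: HX => _ _ _ _; rewrite cV add0n card_prod cV mul0n leqn0 => -> /eqP; rewrite addn2.
have [Fd HF] := fin_all_exists (fun i => frames HX H3 (FN i) (FT i) (p0, side1)).
have pts j : exists S : GCvert alpha k l, forall i, vertval (Fd i) S = F i (c j).
  have [y ry] : exists y : V * cell k l, realizes alpha p0 (c j) y.
    case/orP: (cP j) => [/(realizes_in_piece HX Hkl p0)[x [_ r]]|].
      by exists (p0, x).
    by move=> /(realizes_across HX Hkl (i := side1) p0)[x [_ r]]; eexists; exact: r.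
  have yc : y \in gc_carrier V k l by case/andP: ry.
  exists (exist _ (gc_class alpha y) (imset_f (@gc_class V alpha k l) yc)) => i.
  have [Fr Fa F0] := HF i.
  by rewrite (vertvalE HX Fr Fa (x := y)) ?inE ?connect0 // (cellval_realizes HX Fr Fa ry) F0.
have [pt Hpt] := fin_all_exists pts.
apply: (@lap_mult_ge (GC alpha k l) _ _ (fun i => vertval (Fd i)) pt) => [|i S|i j].
- exact: gc_adj_sym.
- have [Fr Fa F0] := HF i; have [Ts [uT mT vT]] := GC_nbhd HX H3 Hkl (mem_rep S).
  have /esym sumT : \sum_(T <- Ts) vertval (Fd i) T = \sum_(T | gc_adj S T) vertval (Fd i) T.
    by rewrite big_uniq //=; apply: eq_bigl => T; rewrite mT.
  have degS : sdeg (G := GC alpha k l) S = 3.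
    rewrite /sdeg cardsE -(eq_card mT) (card_uniqP uT).
    have := congr1 size (vT _ _ Fr Fa); rewrite !size_map => ->.
    by rewrite /tri_nbrs; case: ifP.
  have [/[!carrierE]/andP[tc _] _] := GCvert_class HX (mem_rep S).
  rewrite degS [X in _ - X]sumT -(big_map (vertval (Fd i)) xpredT id) (vT _ _ Fr Fa) big_map.
  have e0 : tri_eigen e (Fd i (p0, side1)) by rewrite (funext F0).
  by rewrite (frame_eigen Fr Fa e0) // mulrBl.
- by rewrite Hpt dual.
Qed.
End Transfer.

(** * Invariant eigenfunctions of the hexagonal lattice *)

Definition zsign (x : int) : algC := if (x %% 2 == 0)%Z then 1 else -1.

Lemma zsignS x : zsign (x + 1) = - zsign x.
Proof.
rewrite /zsign; case: ifP => h1; case: ifP => h2; rewrite ?opprK //; exfalso; lia.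
Qed.

Lemma zsignN x : zsign (- x) = zsign x.
Proof. by rewrite /zsign; case: ifP => h1; case: ifP => h2 //; exfalso; lia. Qed.

Lemma zsignD2 x y : zsign (x + 2 * y) = zsign x.
Proof. by rewrite /zsign; case: ifP => h1; case: ifP => h2 //; exfalso; lia. Qed.

(* Along each lattice line [y = b] the values alternate on the triangles having *)
(* a side on that line, [w b] above it and [e * w b] below it. Of the three *)
(* neighbours of a triangle two then cancel and the third is its mirror image. *)
Definition strip (e : algC) (w : int -> algC) (c : ipt) : algC :=
  if is_tri c then
    if (c.1 %% 3)%Z == 1 then zsign (c.1 %/ 3)%Z * w (c.2 %/ 3)%Z
    else e * (zsign (c.1 %/ 3)%Z * w ((c.2 %/ 3)%Z + 1))
  else 0.

Section Strip.
Variables (e : algC) (w : int -> algC).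

Lemma strip_up a b : strip e w (3 * a + 1, 3 * b + 1) = zsign a * w b.
Proof.
rewrite /strip is_tri_up /=.
have -> : ((3 * a + 1) %% 3)%Z == 1 by lia.
have -> : ((3 * a + 1) %/ 3)%Z = a by lia.
by have -> : ((3 * b + 1) %/ 3)%Z = b by lia.
Qed.

Lemma strip_down a b : strip e w (3 * a + 2, 3 * b + 2) = e * (zsign a * w (b + 1)).
Proof.
rewrite /strip is_tri_down /=.
have -> : ((3 * a + 2) %% 3)%Z == 1 = false by lia.
have -> : ((3 * a + 2) %/ 3)%Z = a by lia.
by have -> : ((3 * b + 2) %/ 3)%Z = b by lia.
Qed.

Hypothesis e2 : e * e = 1.

Lemma strip_eigen : tri_eigen e (strip e w).
Proof.
move=> c /is_triP[a [b E]]; rewrite /tri_nbrs; case: E => -> /=.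
  have -> : ((3 * a + 1) %% 3)%Z == 1 by lia.
  rewrite !big_cons big_nil addr0 strip_up.
  have -> : (3 * a + 1 + 1, 3 * b + 1 + 1) = (3 * a + 2, 3 * b + 2) by congr pair; ring.
  have -> : (3 * a + 1 - 2, 3 * b + 1 + 1) = (3 * (a - 1) + 2, 3 * b + 2) by congr pair; ring.
  have -> : (3 * a + 1 + 1, 3 * b + 1 - 2) = (3 * a + 2, 3 * (b - 1) + 2) by congr pair; ring.
  by rewrite !strip_down subrK -[in zsign a * w (b + 1)](subrK 1 a) zsignS; ring.
have -> : ((3 * a + 2) %% 3)%Z == 1 = false by lia.
rewrite !big_cons big_nil addr0 strip_down mulrA e2 mul1r.
have -> : (3 * a + 2 - 1, 3 * b + 2 - 1) = (3 * a + 1, 3 * b + 1) by congr pair; ring.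
have -> : (3 * a + 2 + 2, 3 * b + 2 - 1) = (3 * (a + 1) + 1, 3 * b + 1) by congr pair; ring.
have -> : (3 * a + 2 - 1, 3 * b + 2 + 2) = (3 * a + 1, 3 * (b + 1) + 1) by congr pair; ring.
by rewrite !strip_up zsignS; ring.
Qed.

(** The half turn exchanges the triangles above the line at height [y] with those below height [-y]
    and shifts the alternating sign by one, so the weight must be odd for [e = 1] and even for
    [e = -1]. *)
Lemma strip_opp a b : (forall y, w (- y) = - (e * w y)) ->
  strip e w (- a, - b) = strip e w (a, b).
Proof.
move=> wN; case: (boolP (is_tri (a, b))) => [|nt]; last first.
  have nt' : ~~ is_tri (- a, - b) by move: nt; rewrite /is_tri /=; lia.
  by rewrite /strip (negPf nt) (negPf nt').
move=> /is_triP[x [y [[-> ->]|[-> ->]]]].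
  have -> : (- (3 * x + 1), - (3 * y + 1)) = (3 * - (x + 1) + 2, 3 * - (y + 1) + 2).
    by congr pair; ring.
  rewrite strip_down strip_up zsignN zsignS.
  have -> : - (y + 1) + 1 = - y by ring.
  rewrite wN; transitivity (e * e * (zsign x * w y)); first by ring.
  by rewrite e2 mul1r.
have -> : (- (3 * x + 2), - (3 * y + 2)) = (3 * - (x + 1) + 1, 3 * - (y + 1) + 1).
  by congr pair; ring.
by rewrite strip_down strip_up zsignN zsignS wN; ring.
Qed.

Lemma strip_shift a b s t : (forall y, w (y + 2 * t) = w y) ->
  strip e w (a + 6 * s, b + 6 * t) = strip e w (a, b).
Proof.
move=> wT; case: (boolP (is_tri (a, b))) => [|nt]; last first.
  have nt' : ~~ is_tri (a + 6 * s, b + 6 * t) by move: nt; rewrite /is_tri /=; lia.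
  by rewrite /strip (negPf nt) (negPf nt').
move=> /is_triP[x [y [[-> ->]|[-> ->]]]].
  have -> : (3 * x + 1 + 6 * s, 3 * y + 1 + 6 * t)
      = (3 * (x + 2 * s) + 1, 3 * (y + 2 * t) + 1) by congr pair; ring.
  by rewrite !strip_up zsignD2 wT.
have -> : (3 * x + 2 + 6 * s, 3 * y + 2 + 6 * t)
    = (3 * (x + 2 * s) + 2, 3 * (y + 2 * t) + 2) by congr pair; ring.
by rewrite !strip_down zsignD2 addrAC wT.
Qed.
End Strip.

(** Here [true] stands for eigenvalue 1 and an odd weight, [false] for -1 and an even one. The
    disjunction keeps the value 1 when [j] and [-j] agree mod [2k], as for [j = 0] and [j = k]. *)
Definition wave (e : bool) (k : nat) (j y : int) : algC :=
  let p := (2 * k%:Z %| y - j)%Z in let q := (2 * k%:Z %| y + j)%Z in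
  if e then p%:R - q%:R else (p || q)%:R.

Lemma wave_opp e k j y : wave e k j (- y) = - ((-1) ^+ (~~ e) * wave e k j y).
Proof.
have N x : (2 * k%:Z %| - x)%Z = (2 * k%:Z %| x)%Z by rewrite !dvdzE abszN.
rewrite /wave -opprD N -(N (- y + j)) opprD opprK.
by case: e; rewrite /= ?expr0 ?expr1 ?mul1r ?mulN1r ?opprB ?opprK // orbC.
Qed.

Lemma wave_shift e k j y t : wave e k j (y + 2 * (k%:Z * t)) = wave e k j y.
Proof.
have E x : (2 * k%:Z %| x + 2 * (k%:Z * t))%Z = (2 * k%:Z %| x)%Z.
  by apply: rpredDr; rewrite mulrA dvdz_mulr.
rewrite /wave -!addrA ![2 * (k%:Z * t) + _]addrC !addrA.
by rewrite !E.
Qed.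

Lemma dvdz_small (d x : int) : (`|x| < `|d|)%N -> (d %| x)%Z = (x == 0).
Proof.
move=> lt; rewrite dvdzE -absz_eq0; have [->|] := posnP `|x|%N; first by rewrite dvdn0.
by move=> x0; rewrite gtnNdvd // eqn0Ngt x0.
Qed.

(** Distinct heights in [0..k] are not congruent up to sign mod [2k]. The odd weight vanishes for
    heights 0 and [k], hence the narrower range. *)
Lemma wave_dual (e : bool) k (i j : nat) : (0 < k)%N -> (i + e <= k)%N -> (j + e <= k)%N ->
  (e ==> (0 < i))%N -> wave e k i%:Z j%:Z = (i == j)%:R.
Proof.
move=> k0 ik jk ei; rewrite /wave.
have -> : (2 * k%:Z %| j%:Z - i%:Z)%Z = (i == j) by rewrite dvdz_small; lia.
case: e ik jk ei => /= ik jk ei.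
  have -> : (2 * k%:Z %| j%:Z + i%:Z)%Z = false by rewrite dvdz_small; lia.
  by rewrite subr0.
have [/eqP|] := altP (i =P j); first by rewrite orTb.
move=> ne; congr (nat_of_bool _)%:R; rewrite /= dvdz_small; lia.
Qed.

Theorem theorem1p6 (V : finType) (alpha : V * 'I_3 -> V * 'I_3) :
  plane_cubic_graph alpha -> faces_div3 alpha ->
  (3 <= lap_mult (GC alpha 2 0) 4%:R)%N /\
  (forall k : nat, (0 < k)%N ->
     [/\ ((k.+1)./2 <= lap_mult (GC alpha k 0) 4%:R)%N,
         (k./2 <= lap_mult (GC alpha k 0) 2%:R)%N,
         ((k.+1)./2 <= lap_mult (GC alpha k k) 4%:R)%N
       & (k./2 <= lap_mult (GC alpha k k) 2%:R)%N]).
Proof.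
move=> HX H3.
have shift_k0 (e : bool) k j (m p : int) a b :
    strip ((-1) ^+ (~~ e)) (wave e k j) (a + 6 * m * k%:Z - 6 * p * 0%:Z,
      b + 6 * m * 0%:Z + 6 * p * (k + 0)%:Z) = strip ((-1) ^+ (~~ e)) (wave e k j) (a, b).
  rewrite addn0 -[RHS](@strip_shift _ _ a b (m * k%:Z) (k%:Z * p)) => [|y]; last exact: wave_shift.
  by congr strip; congr pair; ring.
have shift_kk (e : bool) k j (m p : int) a b :
    strip ((-1) ^+ (~~ e)) (wave e k j) (a + 6 * m * k%:Z - 6 * p * k%:Z,
      b + 6 * m * k%:Z + 6 * p * (k + k)%:Z) = strip ((-1) ^+ (~~ e)) (wave e k j) (a, b).
  rewrite PoszD -[RHS](@strip_shift _ _ a b ((m - p) * k%:Z) (k%:Z * (m + 2 * p))) => [|y];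
    last exact: wave_shift.
  by congr strip; congr pair; ring.
have sq (e : bool) : (-1) ^+ (~~ e) * (-1) ^+ (~~ e) = 1 :> algC by rewrite -expr2 sqrr_sign.
have main (e : bool) (k l : nat) : (0 < k)%N -> l = 0%N \/ l = k ->
    (k - e <= lap_mult (GC alpha k l) (3%:R - (-1) ^+ (~~ e))%R)%N.
  move=> k0 lE.
  have Hkl : tame k l by case: lE => ->; [exact: tame_k0|exact: tame_kk].
  (* The shift by [e] skips height 0 in the odd case. The test triangle is the up triangle with
     lower left corner [(0, j + e)], inside the piece as [j + e < k]. *)
  apply: (GC_mult_ge HX H3 Hkl (F := fun i => strip ((-1) ^+ (~~ e)) (wave e k (i + e)%N%:Z))
    (c := fun j => (1, 3 * (j + e)%N%:Z + 1))).
  - by move=> i a b; apply: strip_opp => // y; apply: wave_opp.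
  - by move=> i m p a b; case: lE => ->; [apply: shift_k0|apply: shift_kk].
  - by move=> i; apply: strip_eigen.
  - move=> j; have jk := ltn_ord j; have T : is_tri (1, 3 * (j + e)%N%:Z + 1).
      exact: (is_tri_up 0).
    case: lE => ->; rewrite ?piece_k0 ?piece_kk // T /closed_k0 /closed_kk /=; lia.
  - move=> i j; have ik := ltn_ord i; have jk := ltn_ord j.
    rewrite (strip_up _ _ 0) /zsign /= mul1r wave_dual //; [by rewrite eqn_add2r|lia|lia|].
    by apply/implyP => e1; rewrite addn_gt0 [X in _ || (0 < nat_of_bool X)%N]e1 orbT.
have e4 : 4%:R = 3%:R - (-1) ^+ (~~ false) :> algC by rewrite expr1; ring.
have e2 : 2%:R = 3%:R - (-1) ^+ (~~ true) :> algC by rewrite expr0; ring.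
split.
  rewrite e4; have Hkl := @tame_k0 2 isT.
  (* The line of height 2 meets [T] only in a corner, so its test triangle is the down triangle
     [(5, 5)], which has a side on that line and lies in the piece glued along side 1. *)
  apply: (GC_mult_ge HX H3 Hkl (F := fun i => strip ((-1) ^+ true) (wave false 2 (i : nat)%:Z))
    (c := fun j => if j == 2%N :> nat then (5, 5) else (1, 3 * (j : nat)%:Z + 1))).
  - by move=> i a b; apply: strip_opp => [|y]; [exact: (sq false)|exact: (wave_opp false)].
  - by move=> i m p a b; apply: (shift_k0 false).
  - by move=> i; apply: strip_eigen; exact: (sq false).
  - by case=> -[|[|[|j]]] //= ltj; rewrite !piece_k0.
  - move=> i j; have ik := ltn_ord i; have jk := ltn_ord j.
    case: eqP => [j2|nj2].
      have -> : (5, 5) = (3 * 1 + 2, 3 * 1 + 2) :> ipt by [].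
      rewrite strip_down /zsign /= expr1 mulrA mulN1r opprK mul1r.
      by rewrite -val_eqE /= j2; apply: (@wave_dual false 2 i 2); lia.
    rewrite (strip_up _ _ 0) /zsign /= mul1r -val_eqE.
    by apply: (@wave_dual false 2 i j); lia.
move=> k k0; rewrite e4 e2; split.
- by apply: leq_trans (main false k 0%N k0 _); [lia|left].
- by apply: leq_trans (main true k 0%N k0 _); [lia|left].
- by apply: leq_trans (main false k k k0 _); [lia|right].
- by apply: leq_trans (main true k k k0 _); [lia|right].
Qed.
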